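(* Let $u\in\Omega$, let $q(t)$, $t\in[0,T]$, be the trajectory of $\dot q(t)=\sum_{i=1}^l u_i(t)X_i(q(t))$, $q(0)=q_0$, corresponding to $u$, and let $\vec{\Delta u}=(\Delta u^{(1)},\dots,\Delta u^{(k)})\in\Omega^k\simeq T^k_u\Omega$. Let the $k$-jet at $s=0$ of the curve $s\mapsto\mathrm{End}^t[u+s\circ\vec{\Delta u}]$ be given in local coordinates by $$\mathrm{End}^t[u+s\circ\vec{\Delta u}]=q(t)+s\cdot b^{(1)}(t,\vec{\Delta u})+s^2\cdot b^{(2)}(t,\vec{\Delta u})+\dots+s^k\cdot b^{(k)}(t,\vec{\Delta u})+o(s^k).$$ Then the curves $b^{(m)}(t,\vec{\Delta u})$, $m=1,\dots,k$, satisfy the system of ODEs $$\dot b^{(m)}(t,\vec{\Delta u})=\sum_{r=0}^m\sum_{i=1}^l\Delta u^{(r)}_i(t)\Big(\sum_{\alpha,\ w(\alpha)=m-r}\frac1{\alpha!}\,D^{|\alpha|}_{q(t)}X_i\big[\vec b(t,\vec{\Delta u})^{\alpha}\big]\Big),$$ where $\Delta u^{(0)}:=u$ and $\vec b(t,\vec{\Delta u})=(b^{(1)}(t,\vec{\Delta u}),\dots,b^{(k)}(t,\vec{\Delta u}))$.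
   Context: Control system. $M$ is a smooth $n$-dimensional manifold, $X_1,\dots,X_l$ are smooth, pointwise linearly independent vector fields on $M$, $T>0$, $q_0\in M$ is fixed, and $\Omega$ is a vector subspace of the space $\mathrm{Meas}([0,T],\mathbb{R}^l)$ of measurable maps. For $u\in\Omega$ one considers the Carathéodory solution on $[0,T]$ of $\dot q(t)=\sum_{i=1}^l u_i(t)X_i(q(t))$, $q(0)=q_0$. For $t\in[0,T]$ the end-point map is $\mathrm{End}^t:\Omega\to M$, $\mathrm{End}^t(u)=q(t)$; it is assumed to be defined on all of $\Omega$. Notation. $s\circ\vec{\Delta u}:=s\cdot\Delta u^{(1)}+s^2\cdot\Delta u^{(2)}+\dots+s^k\cdot\Delta u^{(k)}$. Coordinates. The equations are written in a chart of $M$, on any time interval over which $q(t)$ stays in the domain of the chart; $D^{j}_{q(t)}X_i$ is the $j$-th derivative of $X_i$ at $q(t)$ in this chart, a symmetric $j$-linear map, with $D^0_{q(t)}X_i=X_i(q(t))$. ODEs are understood in the Carathéodory sense (for almost every $t$). Multi-indices. A multi-index is $\alpha=(a_1,\dots,a_k)$ with $a_i\ge0$ integers; $|\alpha|=\sum_i a_i$, weight $w(\alpha)=\sum_i i\cdot a_i$, $\alpha!=a_1!\cdots a_k!$. For a $|\alpha|$-linear map $\Phi$ and $\vec b=(b^{(1)},\dots,b^{(k)})$, $\Phi[\vec b^{\,\alpha}]$ means $\Phi$ evaluated with $b^{(i)}$ inserted $a_i$ times for $i=1,\dots,k$. *)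

(* Defs.v *)
From HB Require Import structures.
From mathcomp Require Import all_boot all_order all_algebra.
From mathcomp Require Import all_classical all_reals all_analysis.
From mathcomp Require Import measurable_realfun.

Set Implicit Arguments.
Unset Strict Implicit.
Unset Printing Implicit Defensive.

Import Order.TTheory GRing.Theory Num.Theory.
Import numFieldNormedType.Exports.

Local Open Scope classical_set_scope.
Local Open Scope ring_scope.

(** ** Higher derivatives and smoothness *)

(* [iter_diff f [:: v1; ...; vj] x] is D^j_x f [v1, ..., vj], obtained from
   D^(j+1)_x f [v, w1, ..., wj] = D_x (y |-> D^j_y f [w1, ..., wj]) [v].
   For smooth f it does not depend on the order of the vectors. *)
Fixpoint iter_diff (R : realType) (V W : normedModType R) (f : V -> W)
    (vs : seq V) : V -> W :=
  if vs is v :: vs' then fun x => 'd (iter_diff f vs') x v else f.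

(* C^oo on A; meant for A open and V finite-dimensional, where differentiability
   of x |-> D^j_x f [vs] for all j and vs is the existence of all the
   Frechet derivatives of f on A. *)
Definition smooth_on (R : realType) (V W : normedModType R) (A : set V)
    (f : V -> W) : Prop :=
  forall (vs : seq V) (x : V), A x -> differentiable (iter_diff f vs) x.

(** ** Smooth manifolds and vector fields *)

(* [chart_map] and [chart_inv] are total; only the values of [chart_map] on
   [chart_dom] and of its inverse [chart_inv] on [chart_map @` chart_dom]
   matter. *)
Record chart (R : realType) (n : nat) (M : topologicalType) := Chart {
  chart_dom : set M;
  chart_map : M -> 'rV[R]_n;
  chart_inv : 'rV[R]_n -> M;
  chart_dom_open : open chart_dom;
  chart_img_open : open (chart_map @` chart_dom);
  chart_mapK : forall p, chart_dom p -> chart_inv (chart_map p) = p;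
  chart_map_continuous : forall p, chart_dom p -> {for p, continuous chart_map};
  chart_inv_continuous :
    forall x, (chart_map @` chart_dom) x -> {for x, continuous chart_inv} }.

Record smooth_manifold (R : realType) (n : nat) := SmoothManifold {
  manifold_space :> topologicalType;
  atlas : set (chart R n manifold_space);
  manifold_hausdorff : hausdorff_space manifold_space;
  manifold_second_countable : @second_countable manifold_space;
  atlas_cover : forall p : manifold_space, exists2 c, atlas c & chart_dom c p;
  atlas_compatible : forall c d, atlas c -> atlas d ->
    smooth_on (chart_map c @` (chart_dom c `&` chart_dom d))
      (chart_map d \o chart_inv c) }.

(* A smooth vector field, given by its local representatives: [field_at Y c] is
   Y in the chart c, as a map from (an open subset of) R^n to R^n. *)
Record vector_field (R : realType) (n : nat) (M : smooth_manifold R n) :=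
  VectorField {
    field_at :> chart R n M -> 'rV[R]_n -> 'rV[R]_n;
    field_smooth : forall c, atlas c ->
      smooth_on (chart_map c @` chart_dom c) (field_at c);
    field_transition : forall c d, atlas c -> atlas d ->
      forall p, chart_dom c p -> chart_dom d p ->
        field_at d (chart_map d p) =
        'd (chart_map d \o chart_inv c) (chart_map c p)
          (field_at c (chart_map c p)) }.

Definition pointwise_independent (R : realType) (n l : nat)
    (M : smooth_manifold R n) (X : 'I_l -> vector_field M) : Prop :=
  forall c p, atlas c -> chart_dom c p ->
    row_free (\matrix_(i < l) X i c (chart_map c p)).

(** ** Caratheodory solutions *)

Definition abs_continuous (R : realType) (V : normedModType R) (a b : R)
    (f : R -> V) : Prop :=
  forall e : R, 0 < e -> exists2 d : R, 0 < d &
    forall (N : nat) (I : 'I_N -> R * R),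
      (forall i, a <= (I i).1 /\ (I i).1 <= (I i).2 /\ (I i).2 <= b) ->
      trivIset [set: 'I_N] (fun i => `](I i).1, (I i).2[%classic) ->
      \sum_(i < N) ((I i).2 - (I i).1) < d ->
      \sum_(i < N) `|f (I i).2 - f (I i).1| < e.

(* f is, on the interval J, a Caratheodory solution of f' = g. *)
Definition caratheodory (R : realType) (V : normedModType R) (J : set R)
    (f g : R -> V) : Prop :=
  (forall a b, a <= b -> `[a, b] `<=` J -> abs_continuous a b f) /\
  {ae (@lebesgue_measure R), forall t, J t -> is_derive t 1 f (g t)}.

(** ** The control system *)

Section ControlSystem.
Variables (R : realType) (n l : nat) (M : smooth_manifold R n).
Variables (X : 'I_l -> vector_field M) (T : R) (q0 : M).

(* Controls are functions on R, of which only the values on [0, T] are used. *)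
Definition trajectory (u : R -> 'rV[R]_l) (q : R -> M) : Prop :=
  [/\ {within `[0, T], continuous q},
      q 0 = q0 &
      forall (c : chart R n M) (J : set R), atlas c ->
        is_interval J -> J `<=` `[0, T] -> q @` J `<=` chart_dom c ->
        caratheodory J (chart_map c \o q)
          (fun t => \sum_(i < l) u t 0 i *: X i c (chart_map c (q t)))].

(* When the X i are pointwise independent, a trajectory is unique on [0, T]. *)
Definition endpoint (t : R) (u : R -> 'rV[R]_l) : M :=
  xget (fun=> q0) [set q | trajectory u q] t.

End ControlSystem.

(* Lebesgue measurability on [0, T], componentwise: the sigma-algebra on the
   source is the completion of the Borel one. *)
Definition measurable_control (R : realType) (l : nat) (T : R)
    (u : R -> 'rV[R]_l) : Prop :=
  forall i, @measurable_fun _ _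
    (g_sigma_algebraType (completed_algebra_gen (@lebesgue_measure R)))
    (measurableTypeR R) `[0, T] (fun t => u t 0 i).

(** ** Jets *)

(* Families indexed by 'I_k: the index j stands for the order j + 1. *)

Definition jet_curve (R : realType) (V : lmodType R) (k : nat)
    (b : 'I_k -> V) (s : R) : V := \sum_(j < k) s ^+ j.+1 *: b j.

Definition has_jet (R : realType) (n : nat) (M : topologicalType)
    (c : chart R n M) (k : nat) (gamma : R -> M) (x : 'rV[R]_n)
    (b : 'I_k -> 'rV[R]_n) : Prop :=
  (\forall s \near (0 : R), chart_dom c (gamma s)) /\
  (fun s : R => chart_map c (gamma s) - (x + jet_curve b s))
    =o_ (0 : R) (fun s : R => s ^+ k).

(* Delta u^(r), with Delta u^(0) = u. *)
Definition control_of_order (U : Type) (k : nat) (u : U) (Du : 'I_k -> U)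
    (r : 'I_k.+1) : U :=
  if unlift ord0 r is Some j then Du j else u.

(** ** Multi-indices *)

(* Entries are bounded by k. This loses nothing for weights at most k, since
   each entry of a multi-index is at most its weight. *)
Definition multi_index (k : nat) : finType := {ffun 'I_k -> 'I_k.+1}.

Definition mweight (k : nat) (alpha : multi_index k) : nat :=
  (\sum_(i < k) i.+1 * alpha i)%N.

Definition mfact (k : nat) (alpha : multi_index k) : nat :=
  (\prod_(i < k) (alpha i)`!)%N.

(* The sequence in which b i is repeated alpha i times. *)
Definition minsert (V : Type) (k : nat) (b : 'I_k -> V)
    (alpha : multi_index k) : seq V :=
  flatten [seq nseq (alpha i) (b i) | i <- enum 'I_k].

(* Main.v *)
(** In a chart, let x(t) be the reference trajectory and y(s, t) the end-point
    of the control u + jet_curve Du s.  Pointwise independence makes every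
    control of Omega integrable: it is recovered from the derivative of its
    trajectory by a local right inverse of the matrix of the fields.  For small
    s, a continuation argument with Gronwall's inequality keeps y(s, .) in a
    compact tube around x on [a, b], and y(s, .) - x = O(s) uniformly.
    Inductively, if b^(1), ..., b^(m) are bounded and solve their equations and
    y - x - sum_(j <= m) s^j b^(j) = O(s^(m+1)) uniformly on [a, b], divide the
    integral equation of this remainder by s^(m+1): dominated convergence gives
    the integral equation of b^(m+1), and Gronwall's inequality bounds the next
    remainder.  The coefficients are found by expanding the fields along one
    direction b^(j) at a time, so that no symmetry of higher derivatives is
    needed.  Neither is uniqueness of trajectories: all that matters is that
    [endpoint] evaluates, for each control, one fixed trajectory. *)

Require Import Defs.
From HB Require Import structures.
From mathcomp Require Import all_boot all_order all_algebra.
From mathcomp Require Import all_classical all_reals all_analysis.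
From mathcomp Require Import measurable_realfun ring lra.
Import Order.TTheory GRing.Theory Num.Theory.
Import numFieldNormedType.Exports.
Local Open Scope classical_set_scope.
Local Open Scope ring_scope.

Set Implicit Arguments.
Unset Strict Implicit.
Unset Printing Implicit Defensive.

(** * Absolutely continuous functions *)

(** The data are weak in two ways. Controls are only measurable, so nothing can be integrated until
    the absolute continuity of a trajectory has been turned into integrability of its velocity. And
    the jet is given separately at each t, with no uniformity in t and no regularity of b in t, not
    even measurability. Uniformity has to be created: the jet at the single time a bounds the
    initial remainder, and the differential equation carries this bound over [a, b]. Each such step
    consumes one order of the jet, so remainders of order m are estimated for m < k. Measurability
    of the right-hand side of order m + 1 is a by-product of the passage to the limit, taken along a
    sequence of values of s; for this reason the equations stay in integral form inside the
    induction. Two expansions serve at each order: that of order m gives the dominating function,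
    and that of order m + 1, available once b^(m+1) is known to be bounded, gives the pointwise
    limit. *)

#[global] Instance ae_lebesgue_filter (R : realType) :
  Filter (almost_everywhere (@lebesgue_measure R)).
Proof. exact: (ae_filter_ringOfSetsType (@lebesgue_measure R)). Qed.

Section AbsoluteContinuity.
Variable R : realType.
Local Notation mu := (@lebesgue_measure R).

(* [chain a s b]: successive subintervals of [a, b], listed from right to left. *)
Fixpoint chain (a : R) (s : seq (R * R)) (b : R) : Prop :=
  if s is p :: s' then [/\ chain a s' p.1, p.1 <= p.2 & p.2 <= b] else a <= b.

Lemma chain_le a s b : chain a s b -> a <= b.
Proof.
elim: s b => [//|p s IH] b /= [/IH ap pp pb].
exact: (le_trans ap (le_trans pp pb)).
Qed.

Lemma chain_widen a s b b' : chain a s b -> b <= b' -> chain a s b'.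
Proof.
case: s => [|p s] /=; first exact: le_trans.
by move=> [h1 h2 h3] bb'; split => //; exact: le_trans bb'.
Qed.

Lemma chain_nth a s b i : chain a s b -> (i < size s)%N ->
  [/\ a <= (nth (0, 0) s i).1, (nth (0, 0) s i).1 <= (nth (0, 0) s i).2
    & (nth (0, 0) s i).2 <= b].
Proof.
elim: s b i => [//|p s IH] b [|i] /= [h1 h2 h3] hi.
  by split => //; exact: chain_le h1.
have [h4 h5 h6] := IH _ _ h1 hi; split => //.
exact: (le_trans h6 (le_trans h2 h3)).
Qed.

Lemma chain_nth_lt a s b i j : chain a s b -> (i < j)%N -> (j < size s)%N ->
  (nth (0, 0) s j).2 <= (nth (0, 0) s i).1.
Proof.
elim: s b i j => [//|p s IH] b [|i] [|j] //= [h1 h2 h3] hij hj.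
  by have [] := chain_nth h1 hj.
exact: (IH _ i j h1 hij hj).
Qed.

(** Ordered lists can grow by one interval at a time, as the covering arguments require; the
    disjointness asked for by [abs_continuous] follows from the order. *)
Lemma abs_continuous_chain (V : normedModType R) (a b : R) (f : R -> V) (e : R) :
  abs_continuous a b f -> 0 < e -> exists2 d : R, 0 < d &
    forall s, chain a s b -> \sum_(p <- s) (p.2 - p.1) < d ->
      \sum_(p <- s) `|f p.2 - f p.1| < e.
Proof.
move=> acf e0; have [d d0 hd] := acf e e0; exists d => // s cs sd.
have := hd (size s) (fun i => nth (0, 0) s i).
rewrite (big_nth (0, 0)) big_mkord in sd.
rewrite (big_nth (0, 0)) big_mkord; apply => //.
  by move=> i; have [] := chain_nth cs (ltn_ord i).
have key (i j : 'I_(size s)) : (i < j)%N ->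
    `](nth (0, 0) s i).1, (nth (0, 0) s i).2[%classic `&`
    `](nth (0, 0) s j).1, (nth (0, 0) s j).2[%classic !=set0 -> False.
  move=> ij [x [/=]]; rewrite !in_itv /= => /andP[h1 _] /andP[_ h2].
  by have := lt_le_trans h2 (le_trans (chain_nth_lt cs ij (ltn_ord j)) (ltW h1)); rewrite ltxx.
move=> i j _ _ h; apply/val_inj => /=.
have [ij|ji|//] := ltngtP i j; first by case: (key _ _ ij h).
by rewrite setIC in h; case: (key _ _ ji h).
Qed.

Lemma ball_oo (t d z : R) : t - d < z -> z < t + d -> ball t d z.
Proof. by move=> *; rewrite /ball /= ltr_norml; apply/andP; split; lra. Qed.

Lemma subset_cc (a b y z : R) : a <= y -> z <= b -> `[y, z] `<=` `[a, b].
Proof.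
move=> ay zb t /=; rewrite !in_itv /= => /andP[yt tz].
by rewrite (le_trans ay yt) (le_trans tz zb).
Qed.

(** Real induction. The step carries P across t, from some y on its left to any z on its right, so
    the supremum of the points reached needs no separate closure argument. *)
Lemma cousin_ind (a b : R) (P : R -> Prop) : a <= b -> P a ->
  (forall t, a <= t -> t <= b -> exists2 d : R, 0 < d &
     forall y z, a <= y -> t - d < y -> y <= t -> t <= z -> z < t + d ->
       z <= b -> P y -> P z) ->
  P b.
Proof.
move=> ab Pa step.
pose S := [set t | [/\ a <= t, t <= b & P t]].
have Sa : S a by split.
have Sub : ubound S b by move=> t [].
have Ssup : has_sup S by split; [exists a|exists b].
set t := sup S.
have at_ : a <= t by apply: ub_le_sup => //; exists b.
have tb : t <= b by apply: ge_sup => //; exists a.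
have [d d0 hd] := step t at_ tb.
have [y [ay yb Py] ty] := sup_adherent d0 Ssup.
have yt : y <= t by apply: ub_le_sup => //; exists b.
(* Some y within d of the supremum t satisfies P. Crossing t up to t + d / 2 contradicts the
   supremum, unless b comes first and is then reached directly. *)
have [tdb|btd] := leP (t + d / 2) b.
  have : S (t + d / 2).
    split => //; first by rewrite (le_trans at_)// lerDl divr_ge0 ?ltW.
    by apply: (hd y) => //; [rewrite lerDl divr_ge0 ?ltW|rewrite ltrD2l; lra].
  move/(ub_le_sup (ex_intro _ _ Sub)); rewrite -/t; lra.
by apply: (hd y) => //; lra.
Qed.

(** Induction on the rightmost interval p, which is disjoint from the half-line up to p.1 that
    carries the others; cutting U by this half-line is what lets the induction go through. *)
Lemma chain_lebesgue (U : set R) a s b : measurable U -> chain a s b ->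
  (forall p, p \in s -> `]p.1, p.2[%classic `<=` U) ->
  ((\sum_(p <- s) (p.2 - p.1))%:E <= mu (U `&` `]-oo, b]))%E.
Proof.
move=> mU; elim: s b => [|p s IH] b /=; first by rewrite big_nil.
move=> [h1 h2 h3] hU; rewrite big_cons EFinD.
have {}IH := IH _ h1 (fun q qs => hU q (mem_behead (s := p :: s) qs)).
have -> : (p.2 - p.1)%:E = mu `]p.1, p.2[.
  rewrite lebesgue_measure_itv /= lte_fin; case: ltP => // h.
  by rewrite (@le_anti _ _ p.1 p.2) ?h2 ?h// subrr.
apply: le_trans (leeD (lexx _) IH) _.
rewrite -measureU//=; first last.
- rewrite -subset0 => x [/=]; rewrite !in_itv /= => /andP[hx _] [_].
  by rewrite leNgt hx.
- by apply: measurableI => //.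
apply: le_measure; rewrite ?inE//=.
- apply: measurableU => //; exact: measurableI.
- exact: measurableI.
move=> x [xp|[xU]] /=; last first.
  by rewrite !in_itv /= => xp; split => //; exact: (le_trans xp (le_trans h2 h3)).
split; first by apply: (hU p); rewrite ?mem_head.
move: xp => /=; rewrite !in_itv /= => /andP[_ /ltW xp]; exact: le_trans h3.
Qed.

(* The exceptional null set lies in an open set U of small measure. By Cousin's
   lemma [a, b] splits into intervals on which the local bound holds and
   intervals inside U, whose total contribution is small by absolute
   continuity. *)
Lemma abs_continuous_dominated (V : normedModType R) (a b : R) (f : R -> V)
    (v : R -> R) :
  a <= b -> abs_continuous a b f ->
  (forall y z, a <= y -> y <= z -> z <= b -> v y <= v z) ->
  {ae mu, forall t, a < t < b -> forall e : R, 0 < e -> exists2 d : R, 0 < d &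
     forall y z, a <= y -> z <= b -> t - d < y -> y <= t -> t <= z -> z < t + d ->
       `|f z - f y| <= v z - v y + e * (z - y)} ->
  `|f b - f a| <= v b - v a.
Proof.
move=> ab acf vnd [A [mA A0 sA]].
apply/ler_addgt0Pr => e' e'0.
(* The local bounds cost e per unit of length and the intervals inside U cost e in total, which adds
   up to e * (b - a + 1). *)
pose e := e' / (b - a + 1).
have ba1 : 0 < b - a + 1 by rewrite ltr_wpDl ?subr_ge0.
have e0 : 0 < e by rewrite divr_gt0.
have [d d0 hd] := abs_continuous_chain acf e0.
(* The local bound is assumed on the open interval only, so the endpoints join the exceptional
   set. *)
pose A' := A `|` [set a; b].
have mA' : measurable A' by apply: measurableU => //; apply: measurableU.
have A'0 : mu A' = 0%E.
  apply/eqP; rewrite eq_le measure_ge0 andbT.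
  have h : (mu A' <= mu A + mu [set a; b])%E.
    by apply: measureU2 => //; exact: measurableU.
  have h' : (mu [set a; b] <= mu [set a] + mu [set b])%E by exact: measureU2.
  apply: (le_trans h); apply: (le_trans (leeD (lexx _) h')).
  by rewrite [mu A]A0 !lebesgue_measure_set1 !adde0.
have A'y : (mu A' < +oo)%E by rewrite A'0 ltry.
have [U [oU AU Ud]] := lebesgue_regularity_outer mA' A'y d0.
have mU : measurable U by exact: open_measurable.
have {}Ud : (mu U < d%:E)%E.
  rewrite -(setDUK AU); apply: le_lt_trans Ud.
  have h : (mu (A' `|` (U `\` A')) <= mu A' + mu (U `\` A'))%E.
    by apply: measureU2 => //; exact: measurableD.
  by apply: (le_trans h); rewrite [mu A']A'0 add0e.
(* The chain s collects the intervals inside U; their increments are left unestimated until b is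
   reached. *)
pose P t := exists s, [/\ chain a s t,
  (forall p, p \in s -> `]p.1, p.2[%classic `<=` U) &
  `|f t - f a| <= v t - v a + e * (t - a) + \sum_(p <- s) `|f p.2 - f p.1|].
have : P b.
  apply: (cousin_ind ab).
    by exists [::]; split => //=; rewrite big_nil !subrr normr0 mulr0 !addr0.
  move=> t at_ tb.
  have [tA|tA] := pselect (A' t).
    have /nbhs_ballP[r /= r0 rU] : nbhs t U by apply: open_nbhs_nbhs; split => //; exact: AU.
    exists r => // y z ay ty yt tz zt zb [s [cs sU sf]].
    exists ((y, z) :: s); split => /=.
    - by split => //; exact: le_trans tz.
    - move=> p; rewrite inE => /orP[/eqP ->|/sU//] x /=; rewrite in_itv /= => /andP[yx xz].
      by apply: rU; apply: ball_oo; [exact: lt_trans yx|exact: lt_trans zt].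
    - rewrite big_cons /=.
      have -> : f z - f a = (f z - f y) + (f y - f a) by rewrite addrA subrK.
      apply: (le_trans (ler_normD _ _)).
      have vyz : v y <= v z by apply: vnd => //; exact: le_trans tz.
      have : e * (y - a) <= e * (z - a) by rewrite ler_pM2l ?lerD2r//; exact: le_trans tz.
      lra.
  have tab : a < t < b.
    rewrite !lt_neqAle at_ tb !andbT; apply/andP; split.
    - by apply/eqP => E; apply: tA; right; left.
    - by apply/eqP => E; apply: tA; right; right.
  have {}tA : ~ A t by move=> h; apply: tA; left.
  have /contrapT/(_ tab _ e0)[r r0 hr] := contra_not (sA t) tA.
  exists r => // y z ay ty yt tz zt zb [s [cs sU sf]].
  exists s; split => //; first by apply: chain_widen cs _; exact: le_trans tz.
  have -> : f z - f a = (f z - f y) + (f y - f a) by rewrite addrA subrK.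
  apply: (le_trans (ler_normD _ _)).
  have := hr y z ay zb ty yt tz zt.
  lra.
move=> [s [cs sU sf]].
have : \sum_(p <- s) `|f p.2 - f p.1| < e.
  apply: hd => //; rewrite -lte_fin; apply: le_lt_trans Ud.
  apply: (le_trans (chain_lebesgue mU cs sU)).
  by apply: le_measure; rewrite ?inE//; exact: measurableI.
have <- : e * (b - a + 1) = e' by rewrite /e divfK// gt_eqF.
rewrite mulrDr mulr1; lra.
Qed.

End AbsoluteContinuity.

(** * Increments controlled by derivatives known almost everywhere *)

Section Derivatives.
Variable R : realType.
Local Notation mu := (@lebesgue_measure R).

(** Straddle estimate: y and z lie on the two sides of t, so the errors at y and at z add up to a
    multiple of (t - y) + (z - t) = z - y. *)
Lemma is_derive_dist (V : normedModType R) (f : R -> V) (t : R) (l : V) (e : R) :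
  is_derive t 1 f l -> 0 < e -> exists2 d : R, 0 < d &
    forall y z, t - d < y -> y <= t -> t <= z -> z < t + d ->
      `|f z - f y - (z - y) *: l| <= e * (z - y).
Proof.
move=> [/cvg_ex[l' fl'] Dl] e0.
have E : l' = l by rewrite -Dl; apply/esym/cvg_lim.
subst l'.
have /cvgrPdist_le/(_ e e0) := fl'.
rewrite near_withinE => /nbhs_ballP[d /= d0 hd].
have key x : `|x - t| < d -> `|f x - f t - (x - t) *: l| <= e * `|x - t|.
  move=> xd; have [->|xt] := eqVneq x t.
    by rewrite !subrr scale0r subrr !normr0 mulr0.
  have xt0 : x - t != 0 by rewrite subr_eq0.
  have := hd (x - t); rewrite /ball /= sub0r normrN => /(_ xd xt0).
  rewrite [_ *: 1]mulr1 subrK => h.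
  have -> : f x - f t - (x - t) *: l = - ((x - t) *: (l - (x - t)^-1 *: (f x - f t))).
    by rewrite scalerBr scalerA divff// scale1r opprB.
  by rewrite normrN normrZ mulrC ler_wpM2r.
exists d => // y z ty yt tz zt.
have hy := key y; have hz := key z.
rewrite [`|y - t|]ler0_norm ?subr_le0// in hy; rewrite [`|z - t|]ger0_norm ?subr_ge0// in hz.
have {}hy : `|f y - f t - (y - t) *: l| <= e * - (y - t) by apply: hy; lra.
have {}hz : `|f z - f t - (z - t) *: l| <= e * (z - t) by apply: hz; lra.
have -> : f z - f y - (z - y) *: l =
    (f z - f t - (z - t) *: l) - (f y - f t - (y - t) *: l).
  rewrite (_ : z - y = (z - t) - (y - t)) ?scalerBl; last by ring.
  rewrite -(subrKA (f t) (f z)) -(opprB (f y)).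
  by move: (f z - f t) (f y - f t) => A B; rewrite !opprD addrACA.
apply: (le_trans (ler_normB _ _)); rewrite (le_trans (lerD hz hy))//.
by rewrite -mulrDr; apply: ler_wpM2l; [exact: ltW|lra].
Qed.

(** Mean value inequality for derivatives known almost everywhere. Absolute continuity is asked of
    f; for v monotonicity suffices, since a singular part could only enlarge the right-hand side. *)
Lemma ae_derive_dominated (V : normedModType R) (a b : R) (f g : R -> V)
    (v w : R -> R) :
  a <= b -> abs_continuous a b f ->
  {ae mu, forall t, a < t < b -> is_derive t 1 f (g t)} ->
  (forall y z, a <= y -> y <= z -> z <= b -> v y <= v z) ->
  {ae mu, forall t, a < t < b -> is_derive t 1 v (w t)} ->
  {ae mu, forall t, a < t < b -> `|g t| <= w t} ->
  `|f b - f a| <= v b - v a.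
Proof.
move=> ab acf df vnd dv gw; apply: abs_continuous_dominated => //.
apply: filterS3 df dv gw => t hf hv hgw tab e e0.
have e20 : 0 < e / 2 by rewrite divr_gt0.
have [d1 d10 hd1] := is_derive_dist (hf tab) e20.
have [d2 d20 hd2] := is_derive_dist (hv tab) e20.
exists (Num.min d1 d2); first by rewrite lt_min d10.
move=> y z ay zb; rewrite ltrBlDr -ltrBlDl => h1 yt tz; rewrite -ltrBlDl => h2.
move: h1 h2; rewrite !lt_min => /andP[h11 h12] /andP[h21 h22].
have {}hd1 : `|f z - f y - (z - y) *: g t| <= e / 2 * (z - y) by apply: hd1 => //; lra.
have {}hd2 : `|v z - v y - (z - y) * w t| <= e / 2 * (z - y) by apply: hd2 => //; lra.
have zy : 0 <= z - y by rewrite subr_ge0 (le_trans yt).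
have -> : f z - f y = (f z - f y - (z - y) *: g t) + (z - y) *: g t by rewrite subrK.
apply: (le_trans (ler_normD _ _)); rewrite normrZ (ger0_norm zy).
have := ler_wpM2l zy (hgw tab).
move: hd2; rewrite ler_norml => /andP[]; lra.
Qed.

End Derivatives.

(** * Primitives of integrable functions and the fundamental theorem of calculus *)

Section Primitives.
Variable R : realType.
Local Notation mu := (@lebesgue_measure R).
Implicit Types (f g : R -> R) (a b t : R).

(** Integrating from -oo avoids a base point; the estimates below involve only increments of
    [prim g]. *)
Definition prim g t : R := \int[mu]_(x in `]-oo, t]) g x.

Local Notation integrable g := (mu.-integrable setT (EFin \o g)).

Lemma integrable_sub g (A : set R) : measurable A -> integrable g ->
  mu.-integrable A (EFin \o g).
Proof. by move=> mA; apply: integrableS. Qed.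

Lemma EFin_Rintegral g (A : set R) : measurable A -> integrable g ->
  (\int[mu]_(x in A) g x)%:E = (\int[mu]_(x in A) (g x)%:E)%E.
Proof.
by move=> mA ig; rewrite /Rintegral fineK//; apply: integrable_fin_num => //; exact: integrable_sub.
Qed.

Lemma prim_sub g a b : integrable g -> a <= b ->
  prim g b - prim g a = \int[mu]_(x in `]a, b[) g x.
Proof.
move=> ig ab; rewrite /prim Rintegral_itvB; first last.
- by rewrite bnd_simp.
- by rewrite bnd_simp.
- exact: integrable_sub.
by rewrite Rintegral_itv_bndo_bndc//; exact: integrable_sub.
Qed.

Lemma integrable_normr g : integrable g -> integrable (fun x => `|g x|).
Proof. by move=> ig; apply: integrable_norm. Qed.

Lemma prim_nondecreasing g a b : integrable g -> (forall x, 0 <= g x) ->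
  a <= b -> prim g a <= prim g b.
Proof.
move=> ig g0 ab; rewrite -subr_ge0 prim_sub//; exact: Rintegral_ge0.
Qed.

(** Absolute continuity of the integral of [|g|], applied to the union of the given intervals. *)
Lemma prim_abs_continuous g a b : integrable g -> abs_continuous a b (prim g).
Proof.
move=> ig e e0.
have [d [d0 hd]] := integral_normr_continuous ig e0.
exists d => // N I hI tI sI.
pose F (i : 'I_N) := `](I i).1, (I i).2[%classic : set R.
have mF i : measurable (F i) by exact: measurable_itv.
have Fl i : mu (F i) = ((I i).2 - (I i).1)%:E.
  rewrite lebesgue_measure_itv /= lte_fin; have [_ [h _]] := hI i.
  by case: ltP => // h'; rewrite (@le_anti _ _ (I i).1 (I i).2) ?h ?h'// subrr.
have mU : measurable (\big[setU/set0]_(i < N) F i) by exact: bigsetU_measurable.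
have muE : mu (\big[setU/set0]_(i < N) F i) = (\sum_(i < N) ((I i).2 - (I i).1))%:E.
  rewrite -sumEFin; under [RHS]eq_bigr do rewrite -Fl.
  exact: (@measure_bigsetU_ord _ _ _ mu N xpredT F mF tI).
have mud : (mu (\big[setU/set0]_(i < N) F i) < d%:E)%E by rewrite muE lte_fin.
have := hd _ mU mud; apply: le_lt_trans.
rewrite -lee_fin -sumEFin.
have ig' := integrable_normr ig.
have -> : (\int[mu]_(x in \big[setU/set0]_(i < N) F i) `|g x|)%:E =
    (\sum_(i < N) \int[mu]_(x in F i) (`|g x|)%:E)%E.
  rewrite EFin_Rintegral//.
  rewrite (_ : \big[_/_]_(i < N) F i = \big[setU/set0]_(i <- index_enum 'I_N) F i)//.
  rewrite integral_bigsetU_EFin//; first exact: index_enum_uniq.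
  - by apply: sub_trivIset tI.
  - have /measurable_int := integrable_sub mU ig'; exact.
apply: lee_sum => i _.
have [_ [h _]] := hI i.
rewrite -EFin_Rintegral//.
by rewrite lee_fin prim_sub//; apply: le_normr_Rintegral => //; exact: integrable_sub.
Qed.

Lemma prim_derive g : integrable g ->
  {ae mu, forall t, is_derive t 1 (prim g) (g t)}.
Proof.
move=> ig.
have locg : locally_integrable [set: R] g.
  by have := @integrable_locally _ g setT measurableT ig; rewrite patch_setT.
have := @FTC1Ny R g (fun y => integrable_sub (measurable_itv _) ig) locg.
apply: filterS => t [h1 h2]; apply: DeriveDef; first exact: h1.
by rewrite -derive1E.
Qed.

Lemma abs_continuousS (V : normedModType R) a b a' b' (f : R -> V) : a <= a' -> b' <= b ->
  abs_continuous a b f -> abs_continuous a' b' f.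
Proof.
move=> aa bb acf e e0; have [d d0 hd] := acf e e0; exists d => // N I hI.
apply: hd => i; have [h1 [h2 h3]] := hI i; split; first exact: le_trans h1.
by split => //; exact: le_trans bb.
Qed.

Lemma eq_abs_continuous (V : normedModType R) a b (f g : R -> V) :
  (forall t, a <= t -> t <= b -> f t = g t) ->
  abs_continuous a b f -> abs_continuous a b g.
Proof.
move=> fg acf e e0; have [d d0 hd] := acf e e0; exists d => // N I hI tI sI.
rewrite (eq_bigr (fun i => `|f (I i).2 - f (I i).1|)); first exact: hd.
move=> i _; have [h1 [h2 h3]] := hI i.
by rewrite !fg//; [exact: le_trans h3|exact: le_trans h2].
Qed.

Lemma abs_continuous_lin (V : normedModType R) a b (f g : R -> V) (k : R) :
  abs_continuous a b f -> abs_continuous a b g ->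
  abs_continuous a b (fun t => f t + k *: g t).
Proof.
move=> acf acg e e0.
have k1 : 0 < 2 * (`|k| + 1) by rewrite mulr_gt0// ltr_wpDl.
have [d1 d10 h1] := acf _ (divr_gt0 e0 (ltr0Sn _ 1)).
have [d2 d20 h2] := acg _ (divr_gt0 e0 k1).
exists (Num.min d1 d2); first by rewrite lt_min d10.
move=> N I hI tI; rewrite lt_min => /andP[s1 s2].
have {}h1 := h1 N I hI tI s1; have {}h2 := h2 N I hI tI s2.
apply: (@le_lt_trans _ _ (\sum_(i < N) (`|f (I i).2 - f (I i).1| + `|k| * `|g (I i).2 - g (I i).1|))).
  apply: ler_sum => i _; rewrite -normrZ scalerBr.
  by rewrite opprD addrACA; exact: ler_normD.
rewrite big_split /= -mulr_sumr.
have : `|k| * \sum_(i < N) `|g (I i).2 - g (I i).1| <= e / 2.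
  apply: (@le_trans _ _ ((`|k| + 1) * (e / (2 * (`|k| + 1))))).
    apply: ler_pM => //; first exact: sumr_ge0.
    - by rewrite lerDl.
    - exact: ltW.
  rewrite le_eqVlt; apply/orP; left; apply/eqP; field.
  by rewrite gt_eqF// ltr_wpDl.
by move=> h3; rewrite (splitr e) ltr_leD.
Qed.

(** The difference of f and [prim g] is absolutely continuous with zero derivative almost
    everywhere, hence its increments are dominated by those of the zero function. *)
Lemma abs_continuous_prim f g a b : a <= b -> abs_continuous a b f ->
  integrable g -> {ae mu, forall t, a < t < b -> is_derive t 1 f (g t)} ->
  f b - f a = prim g b - prim g a.
Proof.
move=> ab acf ig df.
have acp := @prim_abs_continuous g a b ig.
pose h t := f t + (-1) *: prim g t.
have : `|h b - h a| <= 0 - 0.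
  apply: (@ae_derive_dominated _ _ a b h (fun=> 0) (fun=> 0) (fun=> 0)) => //.
  - exact: abs_continuous_lin.
  - apply: filterS2 df (prim_derive ig) => t hf hp /hf {}hf.
    rewrite -[0](subrr (g t)) -[X in _ - X]scale1r -scaleNr.
    exact: is_deriveD.
  - apply: filterS (prim_derive ig) => t _ _; exact: is_derive_cst.
  - by apply: filterS (prim_derive ig) => t _ _; rewrite normr0.
rewrite subr0 normr_le0 /h !scaleN1r => /eqP; lra.
Qed.

End Primitives.

(** * Integrability of the derivative of an absolutely continuous function *)

Section DerivativeIntegrable.
Variable R : realType.
Local Notation mu := (@lebesgue_measure R).
Local Notation integrable g := (mu.-integrable setT (EFin \o g)).

Lemma chain_length (a : R) s b : chain a s b -> \sum_(p <- s) (p.2 - p.1) <= b - a.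
Proof.
elim: s b => [|p s IH] b /=; first by rewrite big_nil subr_ge0.
by move=> [/IH h1 h2 h3]; rewrite big_cons; lra.
Qed.

(** The majorant is the variation of f on [a, t], as a supremum over chains. It is at most 1 because
    [a, b] is shorter than d; longer intervals are treated later by gluing short ones. *)
Lemma variation_majorant (V : normedModType R) (a b d : R) (f : R -> V) :
  (forall s, chain a s b -> \sum_(p <- s) (p.2 - p.1) < d ->
     \sum_(p <- s) `|f p.2 - f p.1| < 1) ->
  b - a < d ->
  exists v : R -> R, forall y z, a <= y -> y <= z -> z <= b ->
    `|f z - f y| <= v z - v y.
Proof.
move=> hf bad.
pose S t := [set x | exists2 s, chain a s t & x = \sum_(p <- s) `|f p.2 - f p.1|].
have Sub t : t <= b -> has_ubound (S t).
  move=> tb; exists 1 => _ [s cs ->]; apply/ltW/hf; first exact: chain_widen tb.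
  by apply: le_lt_trans bad; apply: chain_length; exact: chain_widen tb.
exists (fun t => sup (S t)) => y z ay yz zb.
rewrite lerBrDr -lerBrDl; apply: ge_sup.
  by exists 0, [::] => //; rewrite big_nil.
move=> _ [s cs ->]; rewrite lerBrDl; apply: ub_le_sup; first exact: Sub.
by exists ((y, z) :: s); rewrite ?big_cons.
Qed.

Lemma abs_continuous_unif (V : normedModType R) (a b e : R) (f : R -> V) :
  abs_continuous a b f -> 0 < e -> exists2 d : R, 0 < d &
    forall y z, a <= y -> y <= b -> a <= z -> z <= b -> `|z - y| < d ->
      `|f z - f y| < e.
Proof.
move=> acf e0; have [d d0 hd] := abs_continuous_chain acf e0; exists d => //.
have key y z : a <= y -> y <= z -> z <= b -> `|z - y| < d -> `|f z - f y| < e.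
  move=> ay yz zb; rewrite ger0_norm ?subr_ge0// => yzd.
  by have := hd [:: (y, z)]; rewrite !big_seq1 /=; apply.
move=> y z ay yb az zb; have [yz|/ltW zy] := leP y z; first exact: key.
by rewrite distrC [`|f z - _|]distrC; exact: key.
Qed.

Lemma clamp_lipschitz (a b x y : R) :
  `|Num.min b (Num.max a x) - Num.min b (Num.max a y)| <= `|x - y|.
Proof.
have := ler_norm (x - y); have := ler_norm (y - x); rewrite distrC ler_norml.
case: (leP a x) => ?; case: (leP a y) => ?; rewrite !minEle;
by do ?case: ifPn; rewrite -?ltNge => *; apply/andP; split; lra.
Qed.

(* Each primitive of [min(|f'|, n)] is dominated by v, so no differentiability of
   the variation of f is needed. *)
Lemma derive_integrable (f g : R -> R) (a b : R) : a < b ->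
  (exists v : R -> R, forall y z, a <= y -> y <= z -> z <= b ->
    `|f z - f y| <= v z - v y) ->
  abs_continuous a b f ->
  {ae mu, forall t, a < t < b -> is_derive t 1 f (g t)} ->
  exists2 h : R -> R, integrable h &
    {ae mu, forall t, a < t < b -> h t = g t}.
Proof.
move=> ab [v fv] cf df.
(* Clamping the time extends f to a continuous function on the line, so that the difference
   quotients [q n] are measurable. *)
pose c (t : R) := Num.min b (Num.max a t).
have cab t : a <= c t <= b.
  by rewrite /c le_min (ltW ab) le_max lexx /= ge_min lexx.
have cE t : a <= t <= b -> c t = t.
  by move=> /andP[at_ tb]; rewrite /c max_r// min_r.
pose fc t := f (c t).
have cfc : continuous fc.
  move=> t; apply/cvgrPdist_lt => e e0.
  have [d d0 hd] := abs_continuous_unif cf e0.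
  near=> t'; have td : `|t - t'| < d.
    by near: t'; apply/nbhs_ballP; exists d.
  have /andP[? ?] := cab t; have /andP[? ?] := cab t'.
  apply: hd => //; apply: le_lt_trans td.
  exact: clamp_lipschitz.
pose q (n : nat) t : R := n.+1%:R * (fc (t + n.+1%:R^-1) - fc t).
have mq n : measurable_fun setT (q n).
  apply: continuous_measurable_fun => t.
  apply: cvgM; first exact: cvg_cst.
  apply: cvgB; last exact: cfc.
  by apply: continuous_comp; [apply: cvgD; [exact: cvg_id|exact: cvg_cst]|exact: cfc].
(* An upper limit is measurable with no convergence assumed; it equals g wherever f is
   differentiable in ]a, b[ with derivative g. *)
pose h0 t := fine (limn_esup (fun n => (q n t)%:E)).
have mh0 : measurable_fun setT h0.
  apply: measurableT_comp => //; apply: measurable_fun_limn_esup => n.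
  exact/measurable_EFinP.
have hg : {ae mu, forall t, a < t < b -> h0 t = g t}.
  apply: filterS df => t ht tab.
  suff Q : (fun n => (q n t)%:E) @ \oo --> (g t)%:E.
    by rewrite /h0 is_cvg_limn_esupE; [rewrite (cvg_lim _ Q)|apply/cvg_ex; exists (g t)%:E].
  apply: cvg_EFin; first exact: nearW.
  apply/cvgrPdist_le => e e0.
  have [d d0 hd] := is_derive_dist (ht tab) e0.
  move: tab => /andP[at_ tb].
  have mdb : 0 < Num.min d (b - t) by rewrite lt_min d0 subr_gt0.
  near=> n.
  have nd : n.+1%:R^-1 < Num.min d (b - t).
    by near: n; exact: (near_infty_natSinv_lt (PosNum mdb)).
  have nr : n.+1%:R * n.+1%:R^-1 = 1 :> R by rewrite divff.
  move: nd; rewrite lt_min => /andP[nd nb].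
  have n0 : 0 < n.+1%:R^-1 :> R by rewrite invr_gt0.
  have E1 : fc t = f t by rewrite /fc cE//; apply/andP; split; lra.
  have E2 : fc (t + n.+1%:R^-1) = f (t + n.+1%:R^-1).
    by rewrite /fc cE//; move: n0 nb; move: (n.+1%:R^-1) => r *; apply/andP; split; lra.
  rewrite /q /= E1 E2; move: nr n0 nd nb {E1 E2}.
  move: (n.+1%:R^-1) => r nr n0 nd nb.
  have hq : `|f (t + r) - f t - r *: g t| <= e * r.
    by have := hd t (t + r); rewrite (_ : t + r - t = r); [apply; lra|ring].
  rewrite distrC.
  have -> : n.+1%:R * (f (t + r) - f t) - g t =
      n.+1%:R * (f (t + r) - f t - r *: g t).
    by have -> : r *: g t = r * g t by []; rewrite [RHS]mulrBr (mulrA _ r) nr mul1r.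
  rewrite normrM ger0_norm//; apply: le_trans (ler_wpM2l _ hq) _ => //.
  by rewrite mulrCA nr mulr1.
pose h := h0 \_ `]a, b[.
have mh : measurable_fun setT h.
  by apply/(measurable_restrictT _ _).1 => //; exact: measurable_funTS.
exists h; last first.
  by apply: filterS hg => t ht tab; rewrite /h patchE ifT ?ht// inE /= in_itv.
pose k (n : nat) t := Num.min `|h t| n%:R.
have k0 n t : 0 <= k n t by rewrite le_min normr_ge0 ler0n.
have mk n : measurable_fun setT (k n).
  by apply: measurable_minr => //; exact: measurableT_comp.
have kh n t : k n t <= `|h t| by rewrite ge_min lexx.
have hout t : ~ (a < t < b) -> h t = 0.
  by move=> tab; rewrite /h patchE ifF//; apply/negP; rewrite inE /= in_itv.
have ik n : integrable (k n).
  have -> : k n = (k n) \_ `]a, b[.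
    apply/funext => t; rewrite patchE; case: ifPn => //.
    by rewrite notin_setE /= in_itv /= => /hout ht; rewrite /k ht normr0 min_l.
  have <- : (EFin \o k n) \_ `]a, b[ = EFin \o ((k n) \_ `]a, b[) by rewrite restrict_EFin.
  apply: (integrable_mkcond _ _).1 => //.
  apply: (@measurable_bounded_integrable _ _ _ mu (k n)) => //.
  - by rewrite /= lebesgue_measure_itv /= lte_fin ab ltry.
  - by apply: measurable_funTS; exact: mk.
  - exists n%:R; split => // x nx t _ /=; rewrite ger0_norm//.
    by apply: le_trans (ltW nx); rewrite ge_min lexx orbT.
have vnd y z : a <= y -> y <= z -> z <= b -> v y <= v z.
  by move=> ay yz zb; rewrite -subr_ge0; apply: le_trans (fv _ _ ay yz zb).
have bnd n : prim (k n) b - prim (k n) a <= v b - v a.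
  apply: le_trans (ler_norm _) _.
  apply: abs_continuous_dominated; [exact: ltW|exact: prim_abs_continuous|exact: vnd|].
  apply: filterS3 df hg (prim_derive (ik n)) => t ht hgt hp tab e e0.
  have e20 : 0 < e / 2 by rewrite divr_gt0.
  have [d1 d10 hd1] := is_derive_dist (ht tab) e20.
  have [d2 d20 hd2] := is_derive_dist hp e20.
  exists (Num.min d1 d2); first by rewrite lt_min d10.
  move=> y z ay zb; rewrite ltrBlDr -ltrBlDl => h1 yt tz; rewrite -ltrBlDl => h2.
  move: h1 h2; rewrite !lt_min => /andP[h11 h12] /andP[h21 h22].
  have {}hd1 : `|f z - f y - (z - y) *: g t| <= e / 2 * (z - y) by apply: hd1 => //; lra.
  have {}hd2 : `|prim (k n) z - prim (k n) y - (z - y) * k n t| <= e / 2 * (z - y).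
    by apply: hd2 => //; lra.
  have yz : y <= z by exact: le_trans tz.
  have zy : 0 <= z - y by rewrite subr_ge0.
  have hk : (z - y) * k n t <= `|(z - y) *: g t|.
    rewrite normrZ (ger0_norm zy); apply: ler_wpM2l => //.
    by apply: le_trans (kh n t) _; rewrite /h patchE hgt//; case: ifP => // _; rewrite normr0.
  have := fv _ _ ay yz zb.
  have : `|(z - y) *: g t| <= `|f z - f y| + e / 2 * (z - y).
    rewrite -[(z - y) *: _](subKr (f z - f y)); apply: le_trans (ler_normB _ _) _.
    by rewrite lerD2l.
  move: hd2; rewrite ler_norml => /andP[hl hr].
  rewrite [`|prim (k n) z - _|]ger0_norm; last by rewrite subr_ge0; exact: prim_nondecreasing.
  lra.
apply/integrableP; split; first exact/measurable_EFinP.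
have kE t : (fun n => (k n t)%:E) @ \oo --> `|(h t)%:E|%E.
  apply: cvg_near_cst.
  near=> n; rewrite /k min_l//.
  by near: n; exact: nbhs_infty_ger.
rewrite (_ : (\int[mu]_x _ = \int[mu]_x (limn (fun n => (k n x)%:E)))%E); last first.
  by apply: eq_integral => t _; apply/esym/cvg_lim.
(* The bound v b - v a is uniform in n, so it passes from the truncations to the integral of
   [|h|]. *)
rewrite monotone_convergence//; first last.
- move=> t _ m n mn; rewrite lee_fin /k le_min ge_min lexx /=.
  by rewrite ge_min ler_nat mn orbT.
- by move=> n t _; rewrite lee_fin.
- by move=> n; apply/measurable_EFinP; exact: mk.
apply: (@le_lt_trans _ _ (v b - v a)%:E); last by rewrite ltry.
apply: lime_le.
  apply: ereal_nondecreasing_is_cvgn => m n mn; apply: ge0_le_integral => //.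
  - by move=> t _; rewrite lee_fin.
  - by apply/measurable_EFinP; exact: mk.
  - by apply/measurable_EFinP; exact: mk.
  - move=> t _; rewrite lee_fin /k le_min ge_min lexx /=.
    by rewrite ge_min ler_nat mn orbT.
apply: nearW => n; rewrite -EFin_Rintegral// lee_fin.
apply: le_trans (bnd n); rewrite (prim_sub (ik n) (ltW ab)).
rewrite le_eqVlt; apply/orP; left; apply/eqP.
rewrite [RHS]Rintegral_mkcond; apply: eq_Rintegral => t _.
rewrite patchE; case: ifPn => //.
by rewrite notin_setE /= in_itv /= => /hout ht; rewrite /k ht normr0 min_l.
Unshelve. all: by end_near.
Qed.

End DerivativeIntegrable.

(** * Taylor expansion along a jet *)

Section Taylor.
Variable R : realType.

(** Mean value inequality for vector values, by real induction on the bound (C + e) * t; the slack e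
    absorbs the error in the definition of the derivative. *)
Lemma derive_bounded (W : normedModType R) (f g : R -> W) (C : R) :
  (forall t : R, 0 <= t -> t <= 1 -> is_derive t 1 f (g t)) ->
  (forall t : R, 0 <= t -> t <= 1 -> `|g t| <= C) ->
  forall t : R, 0 <= t -> t <= 1 -> `|f t - f 0| <= C.
Proof.
move=> df gC t t0 t1.
have C0 : 0 <= C by apply: le_trans (gC 0 (lexx _) ler01).
apply/ler_addgt0Pr => e e0.
suff : `|f t - f 0| <= (C + e) * t.
  move/le_trans; apply; apply: (@le_trans _ _ ((C + e) * 1)); last by rewrite mulr1.
  by apply: ler_wpM2l => //; lra.
pose P t := `|f t - f 0| <= (C + e) * t.
have : P t; last by [].
apply: (@cousin_ind R 0 t P) => //; first by rewrite /P subrr normr0 mulr0.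
move=> x x0 xt; have x1 : x <= 1 by lra.
have [d d0 hd] := is_derive_dist (df x x0 x1) e0; exists d => // y z y0 xy yx xz zx zt Py.
have yz : 0 <= z - y by lra.
have h := hd y z xy yx xz zx.
rewrite /P -[f z](subrK (f y)) -addrA (le_trans (ler_normD _ _))//.
have : `|f z - f y| <= (C + e) * (z - y).
  rewrite -[f z - f y](subrK ((z - y) *: g x)) (le_trans (ler_normD _ _))//.
  rewrite normrZ (ger0_norm yz); have := ler_wpM2l yz (gC x x0 x1); lra.
move: Py; rewrite /P; lra.
Qed.

Lemma is_derive_scalel (W : normedModType R) (f : R -> R) (w : W) (t l : R) :
  is_derive t 1 f l -> is_derive t 1 (fun x => f x *: w) (l *: w).
Proof.
move=> [/cvg_ex[l' fl'] Dl].
have E : l' = l by rewrite -Dl; apply/esym/cvg_lim.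
subst l'.
have cv : (fun h : R => h^-1 *: ((f (h *: 1 + t)) *: w - f t *: w)) @ 0^' --> l *: w.
  under eq_fun do rewrite -scalerBl scalerA.
  exact: cvgZr_tmp.
split; first by apply/cvg_ex; exists (l *: w).
exact/cvg_lim.
Qed.

Lemma is_derive_monomial (a : nat) (t : R) :
  is_derive t 1 (fun x : R => x ^+ a.+1 / a.+1`!%:R) (t ^+ a / a`!%:R).
Proof.
have h : is_derive t 1 (fun x : R => x ^+ a.+1) (a.+1%:R * t ^+ a).
  rewrite (_ : (fun x : R => x ^+ a.+1) = (id : R -> R) ^+ a.+1); last by rewrite exprfctE.
  apply: (is_derive_eq (is_deriveX a.+1 (is_derive_id t (1 : R)))).
  by rewrite /= [_ *: _]mulr1 mulr_natl.
apply: (is_derive_eq (is_derive_scalel (a.+1`!%:R^-1 : R) h)).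
have a0 : a.+1%:R != 0 :> R by [].
change (a.+1%:R * t ^+ a * (a.+1`!%:R)^-1 = t ^+ a / a`!%:R :> R).
by rewrite factS natrM invfM mulrACA divff// mul1r.
Qed.

(** [phi] lists the successive derivatives of one function. The derivative of the remainder is the
    remainder of the shifted family, so the mean value inequality suffices; the factor 1/(N+1)! of
    the sharp bound is given up. *)
Lemma taylor_bounded (W : normedModType R) (N : nat) (phi : nat -> R -> W) (C : R) :
  (forall j (t : R), 0 <= t -> t <= 1 -> is_derive t 1 (phi j) (phi j.+1 t)) ->
  (forall t : R, 0 <= t -> t <= 1 -> `|phi N.+1 t| <= C) ->
  forall t, 0 <= t -> t <= 1 ->
  `|phi 0%N t - \sum_(a < N.+1) (t ^+ a / a`!%:R) *: phi a 0| <= C.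
Proof.
elim: N phi => [|N IH] phi dphi hC t t0 t1.
  rewrite big_ord_recl big_ord0 addr0 /= expr0 invr1 mulr1 scale1r.
  exact: (derive_bounded (dphi 0%N)).
pose psi (t : R) := phi 0%N t - \sum_(a < N.+2) (t ^+ a / a`!%:R) *: phi a 0.
pose dpsi (t : R) := phi 1%N t - \sum_(a < N.+1) (t ^+ a / a`!%:R) *: phi a.+1 0.
have psi0 : psi 0 = 0.
  rewrite /psi big_ord_recl /= expr0 invr1 mulr1 scale1r big1 ?addr0 ?subrr// => i _.
  by rewrite expr0n /= mul0r scale0r.
suff : `|psi t - psi 0| <= C by rewrite psi0 subr0.
apply: (@derive_bounded _ psi dpsi) => // x x0 x1; last first.
  by apply: (IH (fun j => phi j.+1)).
rewrite /psi /dpsi; apply: is_deriveB; first exact: dphi.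
have -> : (fun t : R => \sum_(a < N.+2) (t ^+ a / a`!%:R) *: phi a 0) =
  cst (phi 0%N 0) + (\sum_(a < N.+1) (fun t : R => (t ^+ a.+1 / a.+1`!%:R) *: phi a.+1 0)).
  apply/funext => y; rewrite big_ord_recl /= expr0 invr1 mulr1 scale1r.
  by rewrite [RHS]/(_ + _) fct_sumE.
rewrite -[X in is_derive _ _ _ X]add0r.
apply: is_deriveD.
apply: is_derive_sum => i.
apply: is_derive_scalel; exact: is_derive_monomial.
Qed.

End Taylor.

(** * Taylor's formula for iterated derivatives, along a line and then along a box *)

Section IterDiff.
Variables (R : realType) (V W : normedModType R).
Implicit Types (A : set V) (f g : V -> W).

Lemma iter_diff_cat f (vs ws : seq V) :
  iter_diff f (vs ++ ws) = iter_diff (iter_diff f ws) vs.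
Proof. by elim: vs => [//|v vs IH]; rewrite cat_cons [LHS]/= IH. Qed.

Lemma smooth_on_iter_diff A f (ws : seq V) :
  smooth_on A f -> smooth_on A (iter_diff f ws).
Proof. by move=> sf vs x Ax; rewrite -iter_diff_cat; exact: sf. Qed.

Lemma is_derive_line g (x w : V) (t : R) : differentiable g (x + t *: w) ->
  is_derive t 1 (fun t => g (x + t *: w)) ('d g (x + t *: w) w).
Proof.
move=> dg.
have E : (fun h : R => h^-1 *: (g (x + (h *: 1 + t) *: w) - g (x + t *: w))) =
  (fun h : R => h^-1 *: (g (h *: w + (x + t *: w)) - g (x + t *: w))).
  by apply/funext => h; rewrite [h *: 1]mulr1 scalerDl addrCA.
have dw : derivable g (x + t *: w) w by exact: diff_derivable.
split; first by rewrite /derivable /= E.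
by rewrite /derive /= E -deriveE.
Qed.

(** The step c is kept apart from the direction v: derivatives are taken along v, where uniform
    bounds are available, and smallness comes from the powers of c. *)
Lemma line_taylor A g (x v : V) (c : R) (N : nat) (C : R) : smooth_on A g ->
  (forall t : R, 0 <= t -> t <= 1 -> A (x + t *: (c *: v))) ->
  (forall t : R, 0 <= t -> t <= 1 ->
    `|iter_diff g (nseq N.+1 v) (x + t *: (c *: v))| <= C) ->
  `|g (x + c *: v) - \sum_(a < N.+1) (c ^+ a / a`!%:R) *: iter_diff g (nseq a v) x|
    <= `|c| ^+ N.+1 * C.
Proof.
move=> sg hA hC.
pose phi (a : nat) (t : R) := c ^+ a *: iter_diff g (nseq a v) (x + t *: (c *: v)).
have := @taylor_bounded R W N phi (`|c| ^+ N.+1 * C) _ _ 1 ler01 (lexx 1).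
rewrite /phi /= expr0 !scale1r.
under eq_bigr do rewrite expr1n scale0r addr0 scalerA mul1r mulrC.
apply.
- move=> j t t0 t1.
  have := is_derive_line (smooth_on_iter_diff (nseq j v) sg [::] (hA t t0 t1)).
  move/(is_deriveZ (c ^+ j)); rewrite linearZ /= [c ^+ j *: _]scalerA -exprSr; exact.
- move=> t t0 t1; rewrite normrZ normrX; apply: ler_wpM2l; last exact: hC.
  by rewrite exprn_ge0.
Qed.

End IterDiff.

Section BoxTaylor.

Definition ffsnoc (T : finType) (p : nat) (q : {ffun 'I_p -> T} * T) :
    {ffun 'I_p.+1 -> T} :=
  [ffun i => if unlift ord_max i is Some j then q.1 j else q.2].

Lemma ffsnoc_bij (T : finType) (p : nat) : bijective (@ffsnoc T p).
Proof.
exists (fun f : {ffun 'I_p.+1 -> T} => ([ffun j : 'I_p => f (lift ord_max j)], f ord_max)).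
- move=> [f t]; rewrite /ffsnoc /=; congr pair; last by rewrite ffunE unlift_none.
  by apply/ffunP => j; rewrite !ffunE liftK.
- move=> f; apply/ffunP => i; rewrite ffunE /=.
  by case: unliftP => [j|] ->; rewrite ?ffunE.
Qed.

Lemma big_ffsnoc (U : nmodType) (T : finType) (p : nat) (F : {ffun 'I_p.+1 -> T} -> U) :
  \sum_f F f = \sum_(a : T) \sum_(f : {ffun 'I_p -> T}) F (ffsnoc (f, a)).
Proof.
rewrite exchange_big pair_big /= (reindex (@ffsnoc T p)) /=; last exact/onW_bij/ffsnoc_bij.
by apply: eq_bigr => -[].
Qed.

Lemma lift_max_widen (p : nat) (i : 'I_p) : lift ord_max i = widen_ord (leqnSn p) i.
Proof. by apply/val_inj; exact: lift_max. Qed.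

(** [minsert] with the number of directions and the bound on the entries made independent, so that
    induction on p is possible; the two coincide for p = k and N = k + 1. *)
Definition directions (V : Type) (p N : nat) (v : 'I_p -> V) (f : {ffun 'I_p -> 'I_N}) :=
  flatten [seq nseq (f i) (v i) | i <- enum 'I_p].

Lemma directions_ffsnoc (V : Type) (p N : nat) (v : 'I_p.+1 -> V)
    (f : {ffun 'I_p -> 'I_N}) (a : 'I_N) :
  directions v (ffsnoc (f, a)) =
  directions (fun i => v (lift ord_max i)) f ++ nseq a (v ord_max).
Proof.
rewrite /directions enum_ordSr map_rcons flatten_rcons ffunE unlift_none /=.
congr (flatten _ ++ _); rewrite -map_comp; apply: eq_map => i /=.
by rewrite -lift_max_widen ffunE liftK.
Qed.

Variables (R : realType) (V W : normedModType R).

(* The last direction is expanded first, since it carries the innermost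
   derivatives of [iter_diff]. *)
Lemma box_taylor (A : set V) (N p : nat) (g : V -> W) (x : V)
    (v : 'I_p -> V) (c : 'I_p -> R) (B C d : R) :
  smooth_on A g ->
  (forall j, `|v j| <= B) -> (forall j, `|c j| <= 1) ->
  (forall j, `|c j| ^+ N.+1 <= d) -> 0 <= d -> 0 <= C ->
  (forall c', (forall j, `|c' j| <= `|c j|) ->
     A (x + \sum_j c' j *: v j) /\
     forall vs, (size vs <= N.+1 * p)%N -> (forall w, w \in vs -> `|w| <= B) ->
       `|iter_diff g vs (x + \sum_j c' j *: v j)| <= C) ->
  `|g (x + \sum_j c j *: v j) -
    \sum_(f : {ffun 'I_p -> 'I_N.+1})
      (\prod_j (c j ^+ f j / (f j)`!%:R)) *: iter_diff g (directions v f) x|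
  <= d * C * (N.+2 ^ p)%:R.
Proof.
elim: p g v c => [|p IH] g v c sg vB c1 cd d0 C0 hA.
  rewrite big_ord0 addr0 (big_pred1 [ffun=> ord0]).
    rewrite big_ord0 scale1r /directions (_ : enum 'I_0 = [::]) /=; last first.
      by apply/size0nil; rewrite size_enum_ord.
    by rewrite subrr normr0 expn0 mulr1 mulr_ge0.
  by move=> f; apply/esym/eqP/ffunP => -[].
rewrite big_ffsnoc.
pose v' i := v (lift ord_max i); pose c' i := c (lift ord_max i).
pose x' := x + \sum_j c' j *: v' j.
have E : x + \sum_j c j *: v j = x' + c ord_max *: v ord_max.
  rewrite big_ord_recr /= addrA; congr (_ + _ + _).
  by apply: eq_bigr => i _; rewrite -lift_max_widen.
have E' (c'' : 'I_p -> R) (t : R) : exists c3 : 'I_p.+1 -> R,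
    (forall i, c3 (lift ord_max i) = c'' i) /\ c3 ord_max = t.
  exists (fun i => if unlift ord_max i is Some j then c'' j else t).
  by split => [i|]; rewrite ?liftK ?unlift_none.
have sumE (c3 : 'I_p.+1 -> R) : \sum_j c3 j *: v j =
    \sum_j c3 (lift ord_max j) *: v' j + c3 ord_max *: v ord_max.
  by rewrite big_ord_recr /=; congr (_ + _); apply: eq_bigr => i _; rewrite -lift_max_widen.
have step1 : `|g (x' + c ord_max *: v ord_max) - \sum_(a < N.+1)
   (c ord_max ^+ a / a`!%:R) *: iter_diff g (nseq a (v ord_max)) x'| <= d * C.
  have hline t : 0 <= t -> t <= 1 -> exists c3 : 'I_p.+1 -> R,
      (forall j, `|c3 j| <= `|c j|) /\
      x' + t *: (c ord_max *: v ord_max) = x + \sum_j c3 j *: v j.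
    move=> t0 t1; have [c3 [h1 h2]] := E' c' (t * c ord_max); exists c3; split.
      move=> j; case: (unliftP ord_max j) => [i|] ->; first by rewrite h1.
      by rewrite h2 normrM (ger0_norm t0) ler_piMl.
    rewrite sumE h2 scalerA addrA; congr (_ + _ + _).
    by apply: eq_bigr => i _; rewrite h1.
  apply: (le_trans (line_taylor (A := A) (C := C) sg _ _)).
  - by move=> t t0 t1; have [c3 [h1 ->]] := hline t t0 t1; have [] := hA c3 h1.
  - move=> t t0 t1; have [c3 [h1 ->]] := hline t t0 t1; have [_ ] := hA c3 h1; apply.
      by rewrite size_nseq mulnS leq_addr.
    by move=> w; rewrite mem_nseq => /andP[_ /eqP ->].
  - exact: ler_wpM2r.
(* The induction hypothesis is applied to the derivative of g of order a along the last direction,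
   with the last coordinate of the box set to 0. The a <= N derivatives already taken fit in the
   allowance (N + 1) * (p + 1). *)
have step2 (a : 'I_N.+1) : `|iter_diff g (nseq a (v ord_max)) x' -
   \sum_(f : {ffun 'I_p -> 'I_N.+1}) (\prod_j (c' j ^+ f j / (f j)`!%:R)) *:
      iter_diff g (directions v (ffsnoc (f, a))) x| <= d * C * (N.+2 ^ p)%:R.
  under eq_bigr do rewrite directions_ffsnoc iter_diff_cat.
  apply: IH => //; [exact: smooth_on_iter_diff|by move=> j; exact: vB|
    by move=> j; exact: c1|by move=> j; exact: cd|].
  move=> c'' hc''; have [c3 [h1 h2]] := E' c'' 0.
  have [|h3 h4] := hA c3.
    move=> j; case: (unliftP ord_max j) => [i|] ->; first by rewrite h1.
    by rewrite h2 normr0.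
  have E3 : \sum_j c3 j *: v j = \sum_j c'' j *: v' j.
    by rewrite sumE h2 scale0r addr0; apply: eq_bigr => i _; rewrite h1.
  rewrite -/v' -E3; split => // vs svs hvs; rewrite -iter_diff_cat; apply: h4.
    by rewrite size_cat size_nseq mulnS addnC leq_add// -ltnS ltnS ltnW.
  move=> w; rewrite mem_cat => /orP[/hvs//|].
  by rewrite mem_nseq => /andP[_ /eqP ->].
rewrite E.
set S1 := \sum_(a < N.+1) (c ord_max ^+ a / a`!%:R) *: iter_diff g (nseq a (v ord_max)) x'.
rewrite -[g _ - _](subrKA S1) (le_trans (ler_normD _ _))//.
(* With d * C factored out, the error constants obey K (p + 1) = 1 + (N + 1) * K p, which (N + 2) ^
   p majorizes. *)
apply: (@le_trans _ _ (d * C + N.+1%:R * (d * C * (N.+2 ^ p)%:R))); last first.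
  have -> : d * C * (N.+2 ^ p.+1)%:R =
      d * C * (N.+2 ^ p)%:R + N.+1%:R * (d * C * (N.+2 ^ p)%:R).
    by rewrite expnS natrM -[N.+2%:R]natr1; ring.
  rewrite lerD2r.
  by rewrite ler_peMr ?mulr_ge0// ler1n expn_gt0.
apply: lerD => //.
rewrite /S1 -sumrB; apply: (le_trans (ler_norm_sum _ _ _)).
rewrite mulr_natl -[X in _ *+ X](card_ord N.+1) -sumr_const; apply: ler_sum => a _.
under [X in _ - X]eq_bigr => f _.
  rewrite big_ord_recr /= !ffunE unlift_none /= mulrC.
  under eq_bigr => i _ do rewrite -lift_max_widen !ffunE liftK.
  rewrite -scalerA.
  over.
rewrite -scaler_sumr -scalerBr normrZ.
rewrite -[leRHS]mul1r; apply: ler_pM => //.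
rewrite normrM normrX normfV normr_nat mulr_ile1//.
- by rewrite exprn_ile1.
- by rewrite invf_le1 ?ltr0n ?fact_gt0// ler1n fact_gt0.
Qed.

End BoxTaylor.

(** * Bounds on iterated derivatives, uniform over a compact set and over bounded directions *)

Section IterDiffBounds.
Variables (R : realType) (n : nat) (W : normedModType R).
Local Notation V := 'rV[R]_n.
Implicit Types (A Z : set V) (f : V -> W).

(** In the outermost slot this is linearity of the differential. Further inside, the expansion holds
    near y because A is open, and can therefore be differentiated. *)
Lemma iter_diff_slot A f (us : seq V) (v : V) (ws : seq V) (y : V) :
  open A -> smooth_on A f -> A y ->
  iter_diff f (us ++ v :: ws) y =
  \sum_(i < n) v 0 i *: iter_diff f (us ++ delta_mx 0 i :: ws) y.
Proof.
move=> oA sf; elim: us y => [|u us IH] y Ay /=.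
  rewrite {1}(row_sum_delta v) linear_sum; apply: eq_bigr => i _.
  by rewrite linearZ.
have dE us' : 'd (iter_diff f us') y u = 'D_u (iter_diff f us') y.
  by rewrite deriveE//; exact: sf.
rewrite dE; under eq_bigr do rewrite dE.
have -> : 'D_u (iter_diff f (us ++ v :: ws)) y =
  'D_u (\sum_(i < n) v 0 i \*: iter_diff f (us ++ delta_mx 0 i :: ws)) y.
  apply: near_eq_derive; near=> z; rewrite IH; first by rewrite fct_sumE.
  by near: z; apply: open_nbhs_nbhs.
rewrite derive_sum; last by move=> i; apply: derivableZ; apply: diff_derivable; exact: sf.
apply: eq_bigr => i _; rewrite deriveZ//; apply: diff_derivable; exact: sf.
Unshelve. all: by end_near. Qed.

Lemma normr_coord (v : V) i : `|v 0 i| <= `|v|.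
Proof. by rewrite [leRHS]mx_normrE (le_bigmax _ (fun ij : 'I_1 * 'I_n => `|v ij.1 ij.2|) (0, i)). Qed.

(** The last vector of [vs] is traded for basis vectors in front of [ws], at the cost of a finite
    sum. Once [vs] is empty, a single continuous function on a compact set remains, so the bound is
    uniform in the directions. *)
Lemma iter_diff_bounded_basis A Z f (B : R) : open A -> smooth_on A f ->
  compact Z -> Z `<=` A -> forall (j : nat) (ws : seq V),
  exists2 C : R, 0 <= C & forall vs, size vs = j -> (forall v, v \in vs -> `|v| <= B) ->
    forall y, Z y -> `|iter_diff f (vs ++ ws) y| <= C.
Proof.
move=> oA sf cZ ZA; elim=> [|j IH] ws.
  have : bounded_set (iter_diff f ws @` Z).
    apply: compact_bounded; apply: continuous_compact => //.
    apply: continuous_in_subspaceT => y; rewrite inE => Zy.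
    by apply: differentiable_continuous; apply: sf; exact: ZA.
  move=> [M [Mr hM]]; exists (`|M| + 1) => // vs /size0nil -> _ y Zy /=.
  by apply: hM; [rewrite ltr_pwDr// ler_norm|exists y].
have /fin_all_exists2[C C0 hC] := fun i : 'I_n => IH (delta_mx 0 i :: ws).
exists (\sum_(i < n) `|B| * C i); first by apply: sumr_ge0 => i _; rewrite mulr_ge0.
move=> vs; case/lastP: vs => [//|vs v]; rewrite size_rcons => -[svs] hvs y Zy.
rewrite cat_rcons (iter_diff_slot _ _ _ oA sf (ZA _ Zy)).
apply: (le_trans (ler_norm_sum _ _ _)); apply: ler_sum => i _.
rewrite normrZ; apply: ler_pM => //.
  apply: le_trans (normr_coord _ _) _; apply: le_trans (ler_norm _).
  by apply: hvs; rewrite mem_rcons mem_head.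
by apply: hC => // w wvs; apply: hvs; rewrite mem_rcons inE wvs orbT.
Qed.

Lemma iter_diff_bounded A Z f (B : R) (K : nat) : open A -> smooth_on A f ->
  compact Z -> Z `<=` A ->
  exists2 C : R, 0 <= C &
    forall vs, (size vs <= K)%N -> (forall v, v \in vs -> `|v| <= B) ->
    forall y, Z y -> `|iter_diff f vs y| <= C.
Proof.
move=> oA sf cZ ZA.
have /fin_all_exists2[C C0 hC] :=
  fun j : 'I_K.+1 => iter_diff_bounded_basis B oA sf cZ ZA j [::].
exists (\sum_j C j); first exact: sumr_ge0.
move=> vs svs hvs y Zy.
have := hC (Ordinal (svs : (size vs < K.+1)%N)) vs erefl hvs y Zy.
rewrite cats0 => /le_trans; apply.
by rewrite (bigD1 (Ordinal (svs : (size vs < K.+1)%N)))//= lerDl sumr_ge0.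
Qed.

(** Taylor's formula of order 0 along the unit vector of r. The segment is required to stay in Z
    because Z need not be convex. *)
Lemma lipschitz_bound A Z f : open A -> smooth_on A f ->
  compact Z -> Z `<=` A ->
  exists2 L : R, 0 <= L & forall y r,
    (forall t : R, 0 <= t -> t <= 1 -> Z (y + t *: r)) ->
    `|f (y + r) - f y| <= L * `|r|.
Proof.
move=> oA sf cZ ZA.
have [L L0 hL] := iter_diff_bounded 1 1 oA sf cZ ZA.
exists L => // y r Zyr; rewrite mulrC.
have [->|r0] := eqVneq r 0; first by rewrite addr0 subrr !normr0 mul0r.
have nr0 : `|r| != 0 by rewrite normr_eq0.
pose e := `|r|^-1 *: r.
have re : r = `|r| *: e by rewrite scalerA divff// scale1r.
have := @line_taylor R _ W A f y e `|r| 0 L sf.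
rewrite -re big_ord1 /= expr0 invr1 mulr1 scale1r expr1 normr_id; apply.
- by move=> t t0 t1; apply: ZA; exact: Zyr.
- move=> t t0 t1; apply: (hL [:: e]) => //; last exact: Zyr.
  by move=> v; rewrite inE => /eqP ->; rewrite normrZ normfV normr_id mulVf.
Qed.

End IterDiffBounds.

Section Tube.
Variables (R : realType) (n : nat).
Local Notation V := 'rV[R]_n.

Lemma closed_ball_compact (x : V) (r : R) : compact [set z : V | `|z - x| <= r].
Proof.
apply: bounded_closed_compact.
  exists (`|x| + r); split; [exact: num_real|move=> M hM z /= hz].
  by rewrite -(subrKC x z) (le_trans (ler_normD _ _))// (le_trans _ (ltW hM))// lerD2l.
rewrite (_ : [set _ | _] = (fun z : V => `|z - x|) @^-1` [set t : R | t <= r])//.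
apply: closed_comp; last exact: closed_le.
move=> z _; apply: (@continuous_comp _ _ _ (fun z : V => z - x) (fun z => `|z|)).
  by apply: continuousB; [exact: cvg_id|exact: cst_continuous].
exact: norm_continuous.
Qed.

(** A covering of K gives a uniform radius; Z is then the sum of K and a closed ball, compact as a
    continuous image of a product. *)
Lemma compact_tube (A K : set V) : open A -> compact K -> K `<=` A ->
  exists r : R, exists Z : set V, [/\ 0 < r, compact Z, Z `<=` A &
    forall y h, K y -> `|h| <= r -> Z (y + h)].
Proof.
move=> oA cK KA.
have /compact_near_coveringP/(_ R (at_right (0 : R)) (fun r y => forall h, `|h| <= r -> A (y + h))) := cK.
have FF : Filter (at_right (0 : R)) := @filter_filter R _ (at_right_proper_filter 0).
move=> /(_ FF)[].
  move=> y Ky.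
  have /nbhs_ballP[e /= e0 he] : nbhs y A by apply: open_nbhs_nbhs; split => //; exact: KA.
  have e2 : 0 < e / 2 by rewrite divr_gt0.
  exists (ball y (e / 2), [set r : R | r < e / 2]).
    split => /=; first exact: nbhsx_ballx.
    exact: nbhs_right_lt.
  move=> [z r] /= [zy re] h hr; apply: he.
  rewrite -ball_normE /ball_ /= opprD addrA.
  move: zy; rewrite -ball_normE /ball_ /= => zy.
  apply: le_lt_trans (ler_normB _ _) _; rewrite (splitr e) ltrD//.
  exact: le_lt_trans re.
move=> e /= e0 he.
pose r := e / 2; have r0 : 0 < r by rewrite divr_gt0.
exists r, ((fun p : V * V => p.1 + p.2) @` (K `*` [set h : V | `|h| <= r])); split => //.
- apply: continuous_compact; last first.
    apply: compact_setX => //; have := @closed_ball_compact 0 r.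
    by rewrite (_ : [set z : V | `|z - 0| <= r] = [set h : V | `|h| <= r])//;
      apply/seteqP; split => h /=; rewrite subr0.
  by apply: continuous_subspaceT => p; exact: add_continuous.
- move=> _ [[y h] [/= Ky hr] <-] /=; apply: (he r) => //=.
  by rewrite sub0r normrN gtr0_norm// /r ltr_pdivrMr// ltr_pMr// ltr1n.
- by move=> y h Ky hr; exists (y, h).
Qed.

End Tube.

(** * Expansion of a field along a jet, ordered by weight *)

Section WeightedTaylor.
Variables (R : realType) (n k : nat) (W : normedModType R).
Local Notation V := 'rV[R]_n.
Implicit Types (A Z : set V) (f : V -> W) (v : 'I_k -> V).

(* The coefficient of s^p in the expansion of f (y + jet_curve v s). *)
Definition jet_coef f v (y : V) (p : nat) : W :=
  \sum_(alpha : multi_index k | mweight alpha == p)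
    ((mfact alpha)%:R)^-1 *: iter_diff f (minsert v alpha) y.

Lemma size_minsert v (alpha : multi_index k) : (size (minsert v alpha) <= k.+1 * k)%N.
Proof.
rewrite /minsert size_flatten /shape -map_comp sumnE big_map big_enum /=.
apply: (@leq_trans (\sum_(i < k) k.+1)); last by rewrite sum_nat_const card_ord mulnC.
by apply: leq_sum => i _; rewrite size_nseq ltnW.
Qed.

Lemma mem_minsert v (alpha : multi_index k) w :
  w \in minsert v alpha -> exists j, w = v j.
Proof.
move=> /flattenP[_ /mapP[j _ ->]]; rewrite mem_nseq => /andP[_ /eqP ->].
by exists j.
Qed.

(** Direction j carries the step s ^+ (j + 1), so the order in s of a Taylor term is the weight of
    its multi-index. *)
Lemma prod_weight (s : R) (alpha : multi_index k) :
  \prod_(j < k) ((s ^+ j.+1) ^+ alpha j / (alpha j)`!%:R) =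
  s ^+ mweight alpha / (mfact alpha)%:R.
Proof.
rewrite big_split /=; congr (_ * _).
  rewrite /mweight; under eq_bigr do rewrite -exprM.
  by rewrite prodrXr.
by rewrite /mfact natr_prod prodfV.
Qed.

Lemma norm_jet_curve v (s B : R) : (forall j, `|v j| <= B) -> 0 <= B -> `|s| <= 1 ->
  forall c, (forall j : 'I_k, `|c j| <= `|s ^+ j.+1|) ->
  `|\sum_j c j *: v j| <= k%:R * B * `|s|.
Proof.
move=> vB B0 s1 c hc; apply: (le_trans (ler_norm_sum _ _ _)).
rewrite -mulrA mulr_natl -[X in _ *+ X](card_ord k) -sumr_const; apply: ler_sum => j _.
rewrite normrZ mulrC; apply: ler_pM => //; apply: (le_trans (hc j)).
by rewrite normrX exprS ler_piMr// exprn_ile1.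
Qed.

(** Three errors are added. Removing r costs a multiple of [|r|] by the Lipschitz bound. Expanding
    to order k in each direction costs a multiple of |s|^(m+1), since every step is at most |s| in
    absolute value and m <= k. Dropping the finitely many terms of weight above m costs the same
    order. The radius r0 is shared equally between the jet and r. *)
Lemma weighted_taylor A Z f (m : nat) (B r0 : R) : open A -> smooth_on A f ->
  compact Z -> Z `<=` A -> 0 <= B -> (m <= k)%N ->
  exists2 C : R, 0 <= C & forall y, (forall h, `|h| <= r0 -> Z (y + h)) ->
    forall v s r, (forall j, `|v j| <= B) -> `|s| <= 1 ->
    k%:R * B * `|s| <= r0 / 2 -> `|r| <= r0 / 2 ->
    `|f (y + jet_curve v s + r) - \sum_(p < m.+1) s ^+ p *: jet_coef f v y p|
      <= C * (`|r| + `|s| ^+ m.+1).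
Proof.
move=> oA sf cZ ZA B0 mk.
have [L L0 hL] := lipschitz_bound oA sf cZ ZA.
have [C C0 hC] := iter_diff_bounded B (k.+1 * k) oA sf cZ ZA.
pose C1 := C * (k.+2 ^ k)%:R; pose C2 := C *+ #|multi_index k|.
have C10 : 0 <= C1 by rewrite mulr_ge0.
have C20 : 0 <= C2 by rewrite mulrn_wge0.
exists (L + C1 + C2); first by rewrite !addr_ge0.
move=> y Zy v s r vB s1 ks rr.
have r00 : 0 <= r0 by have := le_trans (normr_ge0 r) rr; lra.
have hB := norm_jet_curve vB B0 s1.
set Y := y + jet_curve v s.
pose S := \sum_(alpha : multi_index k)
  (\prod_(j < k) ((s ^+ j.+1) ^+ alpha j / (alpha j)`!%:R)) *: iter_diff f (directions v alpha) y.
have e1 : `|f (Y + r) - f Y| <= L * `|r|.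
  apply: hL => t t0 t1; rewrite /Y -addrA; apply: Zy.
  apply: (le_trans (ler_normD _ _)); rewrite (splitr r0); apply: lerD.
    by apply: le_trans ks; exact: hB.
  rewrite normrZ ger0_norm//; apply: le_trans rr; rewrite ler_piMl//.
have e2 : `|f Y - S| <= C1 * `|s| ^+ m.+1.
  have -> : C1 * `|s| ^+ m.+1 = `|s| ^+ m.+1 * C * (k.+2 ^ k)%:R by rewrite /C1; ring.
  apply: (@box_taylor R _ _ A k k f y v (fun j => s ^+ j.+1) B) => //.
  - by move=> j; rewrite normrX exprn_ile1.
  - by move=> j; rewrite normrX -exprM; apply: ler_wiXn2l => //; rewrite mulSn; apply: leq_trans (leq_addr _ _).
  - move=> c hc; have h : Z (y + \sum_j c j *: v j).
      by apply: Zy; apply: le_trans (hB _ hc) _; lra.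
    split; first exact: ZA.
    by move=> vs svs hvs; exact: hC.
have e3 : `|S - \sum_(p < m.+1) s ^+ p *: jet_coef f v y p| <= C2 * `|s| ^+ m.+1.
  under [X in _ - X]eq_bigr do rewrite scaler_sumr.
  rewrite (exchange_big_dep xpredT)//= -sumrB.
  apply: (le_trans (ler_norm_sum _ _ _)).
  rewrite mulrnAl -sumr_const; apply: ler_sum => alpha _.
  rewrite prod_weight.
  have [wm|wm] := ltnP (mweight alpha) m.+1.
    rewrite (big_pred1 (Ordinal wm)); last by move=> i; rewrite eq_sym.
    by rewrite scalerA subrr normr0 mulr_ge0// exprn_ge0.
  rewrite big_pred0; last first.
    by move=> i; apply/negbTE; rewrite gtn_eqF// (leq_trans (ltn_ord i)).
  rewrite subr0 normrZ mulrC; apply: ler_pM => //.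
    apply: hC; first exact: size_minsert.
      by move=> w /mem_minsert[j ->].
    by rewrite -[y]addr0; apply: Zy; rewrite normr0.
  rewrite normrM normrX normfV normr_nat.
  apply: (@le_trans _ _ (`|s| ^+ mweight alpha)); last by rewrite ler_wiXn2l.
  rewrite ler_piMr ?exprn_ge0// invf_le1 ?ler1n ?ltr0n /mfact prodn_gt0// => i;
  exact: fact_gt0.
rewrite -(subrKA S) -(subrKA (f Y) (f (Y + r)) (- S)).
apply: (le_trans (ler_normD _ _)).
have h := ler_normD (f (Y + r) - f Y) (f Y - S).
have h1 : L * `|r| <= (L + C1 + C2) * `|r| by apply: ler_wpM2r => //; lra.
have h2 : (C1 + C2) * `|s| ^+ m.+1 <= (L + C1 + C2) * `|s| ^+ m.+1.
  by apply: ler_wpM2r; [rewrite exprn_ge0|lra].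
lra.
Qed.

End WeightedTaylor.

(** * Gronwall's inequality and passage to the limit *)

Section Gronwall.
Variable R : realType.
Local Notation mu := (@lebesgue_measure R).
Local Notation integrable g := (mu.-integrable setT (EFin \o g)).

Lemma abs_continuous_within (V : normedModType R) (a b : R) (f : R -> V) :
  abs_continuous a b f -> {within `[a, b], continuous f}.
Proof.
move=> acf; apply/subspace_continuousP => t /=; rewrite in_itv /= => /andP[at_ tb].
apply/cvgrPdist_lt => e e0; have [d d0 hd] := abs_continuous_unif acf e0.
rewrite near_withinE; apply/nbhs_ballP; exists d => //= z tz; rewrite in_itv /= => /andP[az zb].
exact: hd.
Qed.

Lemma abs_continuous_comp1 (V W : normedModType R) (a b L : R) (f : R -> V) (g : R -> W) :
  (forall y z, a <= y -> y <= z -> z <= b -> `|g z - g y| <= L * `|f z - f y|) ->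
  abs_continuous a b f -> abs_continuous a b g.
Proof.
move=> gf acf e e0.
have L1 : 0 < `|L| + 1 by rewrite ltr_wpDl.
have [d d0 hd] := acf _ (divr_gt0 e0 L1); exists d => // N I hI tI sI.
have := hd N I hI tI sI; rewrite ltr_pdivlMr// mulrC => h; apply: le_lt_trans h.
rewrite mulr_sumr; apply: ler_sum => i _; have [h1 [h2 h3]] := hI i.
apply: le_trans (gf _ _ h1 h2 h3) _; apply: ler_wpM2r => //.
by apply: le_trans (ler_norm L) _; rewrite lerDl.
Qed.

Section Matrices.
Variable n : nat.
Local Notation V := 'rV[R]_n.

Lemma is_derive_rV (f : R -> V) (t : R) (l : V) :
  (forall i, is_derive t 1 (fun x => f x 0 i) (l 0 i)) -> is_derive t 1 f l.
Proof.
move=> h; have df : derivable f t 1.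
  by apply/derivable_mxP => i j; rewrite (ord1 i); have [] := h j.
split => //; rewrite derive_mx//; apply/rowP => i; rewrite mxE.
by have [_ ->] := h i.
Qed.

Lemma is_derive_coord (f : R -> V) (t : R) (l : V) i :
  is_derive t 1 f l -> is_derive t 1 (fun x => f x 0 i) (l 0 i).
Proof.
move=> [df Dl]; split; first by move/derivable_mxP : df; exact.
by rewrite -Dl derive_mx// mxE.
Qed.

Lemma norm_rV_le (v : V) (M : R) : 0 <= M -> (forall i, `|v 0 i| <= M) -> `|v| <= M.
Proof.
move=> M0 h; rewrite [leLHS]mx_normrE; apply: bigmax_le => // -[i j] _ /=.
by rewrite (ord1 i).
Qed.

Lemma abs_continuous_coord (a b : R) (f : R -> V) i :
  abs_continuous a b f -> abs_continuous a b (fun t => f t 0 i).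
Proof.
apply: (@abs_continuous_comp1 _ _ a b 1) => y z _ _ _; rewrite mul1r.
by apply: le_trans (normr_coord (f z - f y) i); rewrite !mxE.
Qed.

Lemma abs_continuous_sum (W : normedModType R) (a b : R) (I : Type) (s : seq I) (P : pred I)
    (f : I -> R -> W) :
  (forall i, abs_continuous a b (f i)) ->
  abs_continuous a b (fun t => \sum_(i <- s | P i) f i t).
Proof.
move=> h; elim: s => [|i s IH].
  move=> e e0; exists 1 => // N J _ _ _; rewrite big1// => j _.
  by rewrite !big_nil subrr normr0.
have := abs_continuous_lin (if P i then 1 else 0) IH (h i).
apply: eq_abs_continuous => t _ _; rewrite big_cons.
by case: ifP => _; rewrite ?scale1r ?scale0r ?addr0// addrC.
Qed.

Lemma abs_continuous_scale (W : normedModType R) (a b : R) (f : R -> R) (w : W) :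
  abs_continuous a b f -> abs_continuous a b (fun t => f t *: w).
Proof.
apply: (@abs_continuous_comp1 _ _ a b `|w|) => y z _ _ _.
by rewrite -scalerBl normrZ mulrC.
Qed.

Lemma abs_continuous_rV (a b : R) (f : R -> V) :
  (forall i, abs_continuous a b (fun t => f t 0 i)) -> abs_continuous a b f.
Proof.
move=> h.
have := @abs_continuous_sum V a b _ (index_enum 'I_n) xpredT
  (fun i t => f t 0 i *: delta_mx 0 i) (fun i => abs_continuous_scale _ (h i)).
by apply: eq_abs_continuous => t _ _; rewrite -row_sum_delta.
Qed.

End Matrices.

(** The product is cut off outside [a, b], where phi is not controlled, so that integrability can
    always be stated on the whole line. *)
Lemma integrable_cut (a b : R) (g phi : R -> R) : integrable g ->
  {within `[a, b], continuous phi} ->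
  integrable ((fun t => g t * phi t) \_ `[a, b]).
Proof.
move=> ig cphi.
have -> : EFin \o ((fun t => g t * phi t) \_ `[a, b]) =
  (EFin \o (fun t => g t * phi t)) \_ `[a, b] by rewrite restrict_EFin.
apply: (integrable_mkcond _ _).1 => //.
apply: (@integrableMl _ _ _ mu _ _ (EFin \o g) phi) => //; first exact: integrable_sub.
  by apply: subspace_continuous_measurable_fun.
have [M [Mr hM]] : bounded_set (phi @` `[a, b]).
  by apply/compact_bounded; apply: continuous_compact => //; exact: segment_compact.
by exists M; split => // x Mx t tab; apply: (hM x Mx); exists t.
Qed.

(* Let M be the maximum of (|r| + e) exp (- L W), with W the primitive of w
   vanishing at a. Then |r'| <= (M exp (L W))', and comparing increments between
   a and a maximum point gives M <= |r a| + e. *)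
Lemma gronwall (V : normedModType R) (a b L e : R) (r rho : R -> V) (w : R -> R) :
  a <= b -> abs_continuous a b r ->
  {ae mu, forall t, a < t < b -> is_derive t 1 r (rho t)} ->
  integrable w -> (forall t, 0 <= w t) -> 0 <= L -> 0 <= e ->
  (forall t, a <= t <= b -> `|rho t| <= L * w t * (`|r t| + e)) ->
  forall t, a <= t -> t <= b ->
    `|r t| + e <= (`|r a| + e) * expR (L * (prim w b - prim w a)).
Proof.
move=> ab acr dr iw w0 L0 e0 hr.
have [Wt WtE] : exists Wt, Wt = fun t => L * (prim w t - prim w a) by eexists.
pose h t := (`|r t| + e) * expR (- Wt t).
have wnd := prim_nondecreasing iw w0.
have ch : {within `[a, b], continuous h}.
  have c1 := abs_continuous_within acr.
  have c2 := abs_continuous_within (@prim_abs_continuous _ _ a b iw).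
  move=> t; apply: cvgM.
    by apply: cvgD; [apply: cvg_norm; exact: c1|exact: cvg_cst].
  apply: (@continuous_comp (subspace `[a, b]) R R (fun t => - Wt t) expR);
    last exact: continuous_expR.
  rewrite WtE; apply: cvgN; apply: cvgM; first exact: cvg_cst.
  by apply: cvgB; [exact: c2|exact: cvg_cst].
have [t0 t0ab hmax] := EVT_max ab ch.
set M := h t0 in hmax.
move: t0ab; rewrite in_itv /= => /andP[at0 t0b].
have hM t : a <= t -> t <= b -> `|r t| + e <= M * expR (Wt t).
  move=> at_ tb; have : h t <= M by apply: hmax; rewrite in_itv /= at_.
  by rewrite /h expRN -ler_pdivlMr ?invr_gt0 ?expR_gt0// invrK.
have M0 : 0 <= M by rewrite /M /h mulr_ge0 ?addr_ge0 ?expR_ge0.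
have Wa : Wt a = 0 by rewrite WtE subrr mulr0.
have Wnd y z : y <= z -> Wt y <= Wt z.
  by move=> yz; rewrite WtE ler_wpM2l// lerD2r wnd.
have key : `|r t0 - r a| <= M * expR (Wt t0) - M * expR (Wt a).
  apply: (@ae_derive_dominated R V a t0 r rho (fun t => M * expR (Wt t))
    (fun t => M * (L * w t * expR (Wt t)))).
  - exact: at0.
  - exact: abs_continuousS acr.
  - apply: filterS dr => t ht /andP[at_ tt0]; apply: ht; rewrite at_ /=; exact: lt_le_trans t0b.
  - by move=> y z _ yz _; apply: ler_wpM2l; [exact: M0|rewrite ler_expR; exact: Wnd].
  - apply: filterS (prim_derive iw) => t ht _.
    have dW : is_derive t 1 Wt (L * w t).
      rewrite WtE; have := @is_deriveZ R R R^o _ L t 1 _ (@is_deriveB R R R^o (prim w) (cst (prim w a)) t 1 _ _ ht (is_derive_cst _ _ _)).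
      by rewrite subr0.
    have dE := @is_derive1_comp R expR Wt t _ _ (is_derive_expR _) dW.
    have := is_deriveZ M dE; rewrite /= => hh.
    by apply: is_derive_eq hh _; rewrite [expR _ * _]mulrC.
  - apply: filterS (prim_derive iw) => t _ /andP[at_ tt0].
    have tb : t <= b by rewrite (le_trans (ltW tt0)).
    apply: (le_trans (hr t _)); first by rewrite (ltW at_).
    rewrite mulrCA; apply: ler_wpM2l; [by rewrite mulr_ge0|by apply: hM => //; exact: ltW].
have Et0 : `|r t0| + e = M * expR (Wt t0).
  by rewrite /M /h -mulrA -expRD addNr expR0 mulr1.
have Mle : M <= `|r a| + e.
  move: key; rewrite Wa expR0 mulr1 -Et0.
  have := ler_normD (r a) (r t0 - r a); rewrite subrKC; lra.
move=> t at_ tb; apply: (le_trans (hM t at_ tb)).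
apply: ler_pM; [exact: M0|exact: expR_ge0|exact: Mle|].
by rewrite ler_expR WtE in Wnd *; exact: (Wnd t b tb).
Qed.

End Gronwall.

Section DominatedConvergence.
Variable R : realType.
Local Notation mu := (@lebesgue_measure R).
Local Notation integrable g := (mu.-integrable setT (EFin \o g)).

Lemma integrable_cut_scale (D : set R) (h : R -> R) (c : R) :
  integrable (h \_ D) -> integrable ((fun t => c * h t) \_ D).
Proof.
move=> ih.
have -> : EFin \o ((fun t => c * h t) \_ D) = (fun t => c%:E * (EFin \o (h \_ D)) t)%E.
  by apply/funext => t /=; rewrite !patchE; case: ifP => _; rewrite -EFinM ?mulr0.
exact: integrableZl.
Qed.

Lemma integrable_cut_sum (I : Type) (s : seq I) (D : set R) (h : I -> R -> R) :
  (forall j, integrable (h j \_ D)) ->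
  integrable ((fun t => \sum_(j <- s) h j t) \_ D).
Proof.
move=> ih.
have -> : EFin \o ((fun t => \sum_(j <- s) h j t) \_ D) =
    (fun t => \sum_(j <- s) (EFin \o (h j \_ D)) t)%E.
  apply/funext => t /=; rewrite sumEFin patchE; congr EFin.
  case: ifPn => tD; first by apply: eq_bigr => j _; rewrite patchE tD.
  by rewrite big1// => j _; rewrite patchE (negbTE tD).
by apply: integrable_sum => // j _; exact: ih.
Qed.

Lemma integrable_sumr (I : Type) (s : seq I) (h : I -> R -> R) :
  (forall j, integrable (h j)) -> integrable (fun t => \sum_(j <- s) h j t).
Proof.
move=> ih; have := @integrable_cut_sum I s setT h; rewrite patch_setT; apply.
by move=> j; rewrite patch_setT.
Qed.

Lemma integrable_scaler (h : R -> R) (c : R) :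
  integrable h -> integrable (fun t => c * h t).
Proof.
move=> ih; have := @integrable_cut_scale setT h c; rewrite !patch_setT; exact.
Qed.

(** Nothing is assumed on G beyond pointwise convergence: its measurability is inherited from the
    sequence, and its integrability from the dominating K. *)
Lemma prim_dominated_cvg (phi : nat -> R -> R) (G K : R -> R) :
  (forall N, integrable (phi N)) -> integrable K ->
  (forall t, phi ^~ t @ \oo --> G t) -> (forall N t, `|phi N t| <= K t) ->
  integrable G /\ forall a t, a <= t ->
    (fun N => prim (phi N) t - prim (phi N) a) @ \oo --> prim G t - prim G a.
Proof.
move=> iphi iK cphi bphi.
have mphi N : measurable_fun setT (phi N).
  by have /measurable_int/measurable_EFinP := iphi N.
have mG : measurable_fun setT G by apply: measurable_fun_cvg mphi _ => t _; exact: cphi.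
have dct (D : set R) : measurable D -> mu.-integrable D (EFin \o G) /\
    (fun N => (\int[mu]_(x in D) (phi N x)%:E)%E) @ \oo --> (\int[mu]_(x in D) (G x)%:E)%E.
  move=> mD.
  have h1 N : measurable_fun D (EFin \o phi N).
    by apply/measurable_EFinP; exact: measurable_funTS.
  have h2 : measurable_fun D (EFin \o G) by apply/measurable_EFinP; exact: measurable_funTS.
  have h3 : {ae mu, forall t, D t -> (fun N => (EFin \o phi N) t) @ \oo --> (EFin \o G) t}.
    by apply: aeW => t _; apply: cvg_EFin; [exact: nearW|exact: cphi].
  have h4 : {ae mu, forall t N, D t -> (`|(EFin \o phi N) t| <= (EFin \o K) t)%E}.
    by apply: aeW => t N _; rewrite /= lee_fin.
  by have [] := @dominated_convergence _ _ R mu D mD _ _ _ h1 h2 h3 (integrable_sub mD iK) h4.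
have [iG _] := dct setT measurableT; split => // a t at_.
have [_] := dct `]a, t[%classic (measurable_itv _).
rewrite -EFin_Rintegral// prim_sub//.
move/fine_cvg; apply: cvg_trans.
by apply: near_eq_cvg; apply: nearW => N /=; rewrite prim_sub.
Qed.

End DominatedConvergence.

(** * Equations of the jet in a chart *)

Lemma sum_shift (U : nmodType) (m u : nat) (F : nat -> U) :
  \sum_(q < m.+1 | (u <= q)%N) F q = \sum_(p < m.+1 | (u + p <= m)%N) F (u + p)%N.
Proof.
rewrite -(big_mkord (fun q => u <= q)%N) -(big_mkord (fun p => u + p <= m)%N (fun p => F (u + p)%N)).
rewrite -[LHS](@big_nat_widenl _ _ _ u 0 m.+1 xpredT)// -{1}[u]add0n big_addn.
rewrite (@big_nat_widen _ _ _ 0 (m.+1 - u) m.+1)/=; last exact: leq_subr.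
by apply: eq_big => [p|p _]; rewrite ?ltn_subRL ?ltnS// addnC.
Qed.

Section JetCoef.
Variables (R : realType) (n k : nat) (W : normedModType R).
Local Notation V := 'rV[R]_n.
Implicit Types (f : V -> W) (v : 'I_k -> V).

(** A nonzero entry at index j contributes at least j + 1 to the weight. Hence truncating the jet at
    order m leaves the coefficients of order at most m unchanged. *)
Lemma eq_jet_coef f v v' (y : V) (p : nat) :
  (forall j : 'I_k, (j < p)%N -> v j = v' j) -> jet_coef f v y p = jet_coef f v' y p.
Proof.
move=> vv'; apply: eq_bigr => alpha /eqP wp; congr (_ *: iter_diff f _ y).
rewrite /minsert; congr flatten; apply: eq_map => j.
have [jp|pj] := ltnP j p; first by rewrite vv'.
suff -> : alpha j = 0%N :> nat by [].
have : (j.+1 * alpha j <= p)%N by rewrite -wp /mweight (bigD1 j)//= leq_addr.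
case: (nat_of_ord (alpha j)) => // c; rewrite mulnS => h.
by have := leq_trans (leq_trans (leq_addr _ _) h) pj; rewrite ltnn.
Qed.

Lemma jet_coef0 f v (y : V) : jet_coef f v y 0 = f y.
Proof.
rewrite /jet_coef (big_pred1 [ffun=> ord0]).
  rewrite /mfact big1 ?invr1 ?scale1r; last by move=> i _; rewrite ffunE fact0.
  rewrite /minsert (_ : flatten _ = [::])//.
  by elim: (enum 'I_k) => //= j s ->; rewrite ffunE.
move=> alpha; apply/eqP/eqP => [w0|->].
  apply/ffunP => j; rewrite ffunE; apply/val_inj => /=.
  move: w0 => /eqP; rewrite /mweight sum_nat_eq0 => /forallP/(_ j) /=.
  by rewrite muln_eq0 => /eqP.
by rewrite /mweight big1// => j _; rewrite ffunE muln0.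
Qed.

Lemma jet_coef_bounded A Z f (B : R) : open A -> smooth_on A f ->
  compact Z -> Z `<=` A ->
  exists2 C : R, 0 <= C & forall v y p, (forall j, `|v j| <= B) -> Z y ->
    `|jet_coef f v y p| <= C.
Proof.
move=> oA sf cZ ZA; have [C C0 hC] := iter_diff_bounded B (k.+1 * k) oA sf cZ ZA.
exists (C *+ #|multi_index k|); first by rewrite mulrn_wge0.
move=> v y p vB Zy; rewrite /jet_coef big_mkcond /=.
apply: (le_trans (ler_norm_sum _ _ _)); rewrite -sumr_const; apply: ler_sum => alpha _.
case: ifP => _; last by rewrite normr0.
rewrite normrZ -[leRHS]mul1r; apply: ler_pM => //.
  by rewrite normfV normr_nat invf_le1 ?ler1n ?ltr0n /mfact prodn_gt0// => i; exact: fact_gt0.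
by apply: hC => //; [exact: size_minsert|move=> w /mem_minsert[j ->]].
Qed.

End JetCoef.

Section JetOde.
Variables (R : realType) (n l k : nat).
Local Notation V := 'rV[R]_n.
Local Notation mu := (@lebesgue_measure R).
Local Notation integrable g := (mu.-integrable setT (EFin \o g)).
Variables (A Z : set V) (r0 a b s0 : R) (f : 'I_l -> V -> V)
  (g : 'I_k.+1 -> 'I_l -> R -> R) (x : R -> V) (y : R -> R -> V)
  (bb : 'I_k -> R -> V).

Definition rhs (s t : R) : V :=
  \sum_i (\sum_(r < k.+1) s ^+ r * g r i t) *: f i (y s t).

(** The right-hand side of the equation of order p, with the controls replaced by the functions g;
    these will be integrable representatives, equal to the controls almost everywhere. *)
Definition jet_rhs (p : nat) (t : R) : V :=
  \sum_(r < k.+1 | (r <= p)%N) \sum_i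
    g r i t *: jet_coef (f i) (bb ^~ t) (x t) (p - r).

(** Orders are natural numbers here, the reference trajectory being order 0, so that one induction
    covers all the equations; the value 0 beyond order k is a dummy. *)
Definition jet_term (p : nat) (t : R) : V :=
  if p is j.+1 then (if insub j is Some j' then bb j' t else 0) else x t.

Definition jet_poly (m : nat) (s t : R) : V := \sum_(p < m.+1) s ^+ p *: jet_term p t.

Definition control_norm (t : R) : R := \sum_(r < k.+1) \sum_i `|g r i t|.

Lemma jet_poly_trunc m s t : (m <= k)%N ->
  jet_poly m s t = x t + jet_curve (fun j : 'I_k => if (j < m)%N then bb j t else 0) s.
Proof.
move=> mk; rewrite /jet_poly big_ord_recl expr0 scale1r /=; congr (_ + _).
rewrite /jet_curve (big_ord_widen_cond _ xpredT (fun j => s ^+ j.+1 *: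
  (if insub j is Some j' then bb j' t else 0)) mk) big_mkcond /=.
apply: eq_bigr => j _; rewrite /bump /=; case: ifP; last by rewrite scaler0.
by rewrite valK.
Qed.

Lemma jet_poly_full s t : jet_poly k s t = x t + jet_curve (bb ^~ t) s.
Proof.
by rewrite jet_poly_trunc//; congr (_ + _); apply: eq_bigr => j _; rewrite ltn_ord.
Qed.

Lemma control_norm_ge0 t : 0 <= control_norm t.
Proof. by apply: sumr_ge0 => r _; exact: sumr_ge0. Qed.

Hypotheses (oA : open A) (sf : forall i, smooth_on A (f i)) (cZ : compact Z)
  (ZA : Z `<=` A) (r0_gt0 : 0 < r0) (ab : a <= b) (k_gt0 : (0 < k)%N)
  (s0_gt0 : 0 < s0) (s0_le1 : s0 <= 1) (ig : forall r i, integrable (g r i))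
  (xZ : forall t, a <= t -> t <= b -> forall h, `|h| <= r0 -> Z (x t + h))
  (yx : forall s t, `|s| < s0 -> a <= t -> t <= b -> `|y s t - x t| <= r0 / 4)
  (acy : forall s, `|s| < s0 -> abs_continuous a b (y s))
  (dy : forall s, `|s| < s0 ->
    {ae mu, forall t, a < t < b -> is_derive t 1 (y s) (rhs s t)})
  (jet : forall t, a <= t -> t <= b -> forall e, 0 < e -> exists2 d : R, 0 < d &
    forall s, `|s| < d -> `|y s t - jet_poly k s t| <= e * `|s| ^+ k).

Lemma jet_le m t : (m <= k)%N -> a <= t -> t <= b -> forall e, 0 < e ->
  exists2 d : R, 0 < d &
    forall s, `|s| < d -> `|y s t - jet_poly m s t| <= e * `|s| ^+ m.
Proof.
move=> /subnKC; move: (k - m)%N => d; elim: d m => [|d IH] m mk at_ tb e e0.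
  by move: mk; rewrite addn0 => ->; exact: jet.
have [|d1 d10 h1] := IH m.+1 _ at_ tb 1 ltr01; first by rewrite addSnnS.
pose c := 1 + `|jet_term m.+1 t|.
have c0 : 0 < c by rewrite ltr_pwDl.
exists (Num.min d1 (e / c)); first by rewrite lt_min d10 divr_gt0.
move=> s; rewrite lt_min => /andP[sd1 se].
have -> : y s t - jet_poly m s t = (y s t - jet_poly m.+1 s t) + s ^+ m.+1 *: jet_term m.+1 t.
  by rewrite /jet_poly [in RHS]big_ord_recr /= opprD addrA subrK.
apply: (le_trans (ler_normD _ _)); apply: (le_trans (lerD (h1 s sd1) (lexx _))).
rewrite normrZ normrX [`|s| ^+ m.+1 * `|_| ]mulrC -mulrDl -/c exprS mulrA.
apply: ler_wpM2r; first by rewrite exprn_ge0.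
by rewrite mulrC; move/ltW: se; rewrite ler_pdivlMr.
Qed.

(** At s = 0 the estimate of order 0 reads |y 0 t - x t| <= e for every e > 0, because 0 ^+ 0 =
    1. *)
Lemma y0x t : a <= t -> t <= b -> y 0 t = x t.
Proof.
move=> at_ tb; have [d d0 hd] := jet_le (leq0n k) at_ tb ltr01.
apply/eqP; rewrite -subr_eq0 -normr_le0.
apply/ler_addgt0Pr => e e0; rewrite add0r.
have [d' d'0 hd'] := jet_le (leq0n k) at_ tb e0.
have := hd' 0; rewrite normr0 => /(_ d'0).
by rewrite expr0 mulr1 /jet_poly big_ord_recl big_ord0 addr0 expr0 scale1r.
Qed.

(** The fields are expanded along the jet truncated at order m, the remainder of y being the
    perturbation. Zeros replace the components beyond order m, so a bound on the first m components
    is enough. *)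
Lemma rhs_expansion m (B : R) : (m <= k)%N -> 0 <= B ->
  (forall j : 'I_k, (j < m)%N -> forall t, a <= t -> t <= b -> `|bb j t| <= B) ->
  exists2 C : R, 0 <= C & exists2 s1 : R, 0 < s1 <= s0 & forall s t, `|s| < s1 ->
    a <= t -> t <= b ->
    `|rhs s t - \sum_(q < m.+1) s ^+ q *: jet_rhs q t| <=
      C * control_norm t * (`|y s t - jet_poly m s t| + `|s| ^+ m.+1).
Proof.
move=> mk B0 hB.
have /fin_all_exists2[C1 C10 hC1] := fun i => @weighted_taylor _ _ k _ A Z (f i) m B r0 oA (sf i) cZ ZA B0 mk.
have /fin_all_exists2[C2 C20 hC2] := fun i => @jet_coef_bounded _ _ k _ A Z (f i) B oA (sf i) cZ ZA.
pose D1 := \sum_i C1 i; pose D2 := \sum_i C2 i.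
have D10 : 0 <= D1 by exact: sumr_ge0.
have D20 : 0 <= D2 by exact: sumr_ge0.
have hD1 i : C1 i <= D1 by rewrite /D1 (bigD1 i)//= lerDl sumr_ge0.
have hD2 i : C2 i <= D2 by rewrite /D2 (bigD1 i)//= lerDl sumr_ge0.
exists (D1 + D2 *+ m.+1); first by rewrite addr_ge0 ?mulrn_wge0.
(* For |s| < q the truncated jet curve has norm at most r0 / 4; together with [yx] this bounds the
   remainder by r0 / 2. *)
pose q := r0 / 4 / (k%:R * B + 1).
have kB : 0 <= k%:R * B by rewrite mulr_ge0.
have q0 : 0 < q by rewrite !divr_gt0// ltr_wpDl.
exists (Num.min s0 q); first by rewrite lt_min s0_gt0 q0 ge_min lexx.
move=> s t; rewrite lt_min => /andP[ss0 sq] at_ tb.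
have s1 : `|s| <= 1 by rewrite (le_trans (ltW ss0)).
pose v (j : 'I_k) := if (j < m)%N then bb j t else 0.
have vB j : `|v j| <= B by rewrite /v; case: ifP => [/hB|_]; [exact|rewrite normr0].
have kBs : k%:R * B * `|s| <= r0 / 4.
  apply: (@le_trans _ _ ((k%:R * B + 1) * q)); last first.
    by rewrite mulrC divfK// gt_eqF// ltr_wpDl.
  by apply: ler_pM => //; [rewrite lerDl|exact: ltW].
pose r := y s t - jet_poly m s t.
have yE : y s t = x t + jet_curve v s + r.
  by rewrite -jet_poly_trunc// /r subrKC.
have rr : `|r| <= r0 / 2.
  have -> : r = (y s t - x t) - jet_curve v s by rewrite /r jet_poly_trunc// opprD addrA.
  apply: (le_trans (ler_normB _ _)).
  have h1 := norm_jet_curve vB B0 s1 (fun j => lexx `|s ^+ j.+1|).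
  have h2 := yx ss0 at_ tb.
  apply: (le_trans (lerD h2 (le_trans h1 kBs))); lra.
pose T i := \sum_(p < m.+1) s ^+ p *: jet_coef (f i) v (x t) p.
have e1 i : `|f i (y s t) - T i| <= D1 * (`|r| + `|s| ^+ m.+1).
  rewrite {1}yE; apply: le_trans (hC1 i _ (xZ at_ tb) v s r vB s1 _ rr) _.
    by apply: le_trans kBs _; move: r0_gt0; lra.
  by apply: ler_wpM2r => //; rewrite addr_ge0// exprn_ge0.
have Zx : Z (x t) by rewrite -[x t]addr0; apply: xZ => //; rewrite normr0 ltW.
(* The control of order u shifts the expansion by u; the terms pushed beyond order m, at most m + 1
   of them, form the error. *)
have e2 (i : 'I_l) (u : 'I_k.+1) : `|s ^+ u *: T i -
    \sum_(q < m.+1 | (u <= q)%N) s ^+ q *: jet_coef (f i) (bb ^~ t) (x t) (q - u)|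
    <= D2 *+ m.+1 * `|s| ^+ m.+1.
  have -> : \sum_(q < m.+1 | (u <= q)%N) s ^+ q *: jet_coef (f i) (bb ^~ t) (x t) (q - u) =
      \sum_(p < m.+1 | (u + p <= m)%N) s ^+ (u + p) *: jet_coef (f i) v (x t) p.
    rewrite (sum_shift m u (fun q => s ^+ q *: jet_coef (f i) (bb ^~ t) (x t) (q - u))).
    apply: eq_bigr => p _; rewrite addKn; congr (_ *: _); apply: eq_jet_coef => j jp.
    by rewrite /v (leq_trans jp)// -ltnS.
  rewrite /T scaler_sumr (bigID (fun p : 'I_m.+1 => (u + p <= m)%N)) /= addrAC.
  under eq_bigr do rewrite scalerA -exprD.
  rewrite subrr add0r (le_trans (ler_norm_sum _ _ _))// big_mkcond /=.
  rewrite mulrnAl -[X in _ *+ X](card_ord m.+1) -sumr_const; apply: ler_sum => p _.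
  case: ifPn => [|_]; last by rewrite mulr_ge0// exprn_ge0.
  rewrite -ltnNge => mup; rewrite scalerA -exprD normrZ mulrC normrX; apply: ler_pM => //.
  - by apply: le_trans (hC2 i v (x t) p vB Zx) (hD2 i).
  - exact: ler_wiXn2l.
have -> : rhs s t - \sum_(q < m.+1) s ^+ q *: jet_rhs q t =
  \sum_(u < k.+1) \sum_i g u i t *: (s ^+ u *: (f i (y s t) - T i) + (s ^+ u *: T i -
    \sum_(q < m.+1 | (u <= q)%N) s ^+ q *: jet_coef (f i) (bb ^~ t) (x t) (q - u))).
  have -> : rhs s t = \sum_(u < k.+1) \sum_i g u i t *: (s ^+ u *: f i (y s t)).
    rewrite /rhs exchange_big /=; apply: eq_bigr => i _; rewrite scaler_suml.
    by apply: eq_bigr => u _; rewrite scalerA mulrC.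
  have -> : \sum_(q < m.+1) s ^+ q *: jet_rhs q t = \sum_(u < k.+1) \sum_i g u i t *:
      (\sum_(q < m.+1 | (u <= q)%N) s ^+ q *: jet_coef (f i) (bb ^~ t) (x t) (q - u)).
    under eq_bigr do rewrite scaler_sumr.
    rewrite (exchange_big_dep xpredT)//=; apply: eq_bigr => u _.
    under eq_bigr do rewrite scaler_sumr.
    rewrite exchange_big /=; apply: eq_bigr => i _; rewrite scaler_sumr.
    by apply: eq_bigr => q0' _; rewrite !scalerA mulrC.
  rewrite -sumrB; apply: eq_bigr => u _; rewrite -sumrB; apply: eq_bigr => i _.
  by rewrite -scalerBr; congr (_ *: _); rewrite scalerBr subrKA.
rewrite /control_norm mulrAC mulr_sumr.
apply: (le_trans (ler_norm_sum _ _ _)); apply: ler_sum => u _.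
rewrite mulr_sumr.
apply: (le_trans (ler_norm_sum _ _ _)); apply: ler_sum => i _.
rewrite normrZ mulrC; apply: ler_wpM2r => //.
apply: (le_trans (ler_normD _ _)); rewrite mulrDl; apply: lerD.
  rewrite normrZ normrX; apply: le_trans (e1 i).
  by rewrite ler_piMl// exprn_ile1.
apply: (le_trans (e2 i u)); apply: ler_wpM2l; first by rewrite mulrn_wge0.
by rewrite lerDr.
Qed.

(** The integral form passes to the limit under dominated convergence. Integrability is part of the
    definition, since it is not known in advance for a right-hand side built from [bb]. *)
Definition solved (p : nat) := forall i : 'I_n,
  integrable ((fun t => jet_rhs p t 0 i) \_ `[a, b]) /\
  forall t, a <= t -> t <= b -> jet_term p t 0 i - jet_term p a 0 i =
    prim ((fun t => jet_rhs p t 0 i) \_ `[a, b]) t -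
    prim ((fun t => jet_rhs p t 0 i) \_ `[a, b]) a.

Lemma solved_ode p : solved p -> abs_continuous a b (jet_term p) /\
  {ae mu, forall t, a < t < b -> is_derive t 1 (jet_term p) (jet_rhs p t)}.
Proof.
move=> sp; split.
  apply: abs_continuous_rV => i; have [ii si] := sp i.
  apply: (abs_continuous_comp1 (L := 1) _ (@prim_abs_continuous _ _ a b ii)) => z t az zt tb.
  have hz := si z az (le_trans zt tb); have ht := si t (le_trans az zt) tb.
  set G := prim _ in hz ht *.
  by rewrite mul1r (_ : jet_term p t 0 i - jet_term p z 0 i = G t - G z)//; lra.
have : {ae mu, forall t, forall i : 'I_n, a < t < b ->
    is_derive t 1 (fun z => jet_term p z 0 i) (jet_rhs p t 0 i)}.
  apply: filter_forall => i; have [ii si] := sp i.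
  apply: filterS (prim_derive ii) => t ht /andP[at_ tb].
  set G := (fun t => jet_rhs p t 0 i) \_ `[a, b] in ii si ht.
  have Gt : G t = jet_rhs p t 0 i.
    by rewrite /G patchE ifT// inE /= in_itv /= !ltW.
  have hd : is_derive t 1 (prim G + cst (jet_term p a 0 i - prim G a)) (jet_rhs p t 0 i).
    by rewrite -Gt -[X in is_derive _ _ _ X]addr0; apply: is_deriveD.
  apply: near_eq_is_derive hd; near=> z.
  have az : a <= z by apply/ltW; near: z; exact: lt_nbhsr.
  have zb : z <= b by apply/ltW; near: z; exact: lt_nbhsl.
  by have := si z az zb; rewrite addrfctE /=; lra.
apply: filterS => t ht tab; apply: is_derive_rV => i; exact: ht.
Unshelve. all: by end_near. Qed.

Lemma remainder_ode m s : `|s| < s0 -> (forall p, (p <= m)%N -> solved p) ->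
  abs_continuous a b (fun t => y s t - jet_poly m s t) /\
  {ae mu, forall t, a < t < b -> is_derive t 1 (fun t => y s t - jet_poly m s t)
    (rhs s t - \sum_(q < m.+1) s ^+ q *: jet_rhs q t)}.
Proof.
move=> ss0 sm.
have so (p : 'I_m.+1) := solved_ode (sm p (ltn_ord p : (p <= m)%N)).
split.
  have acP : abs_continuous a b (jet_poly m s).
    apply: abs_continuous_sum => p; have [acp _] := so p.
    apply: (abs_continuous_comp1 (L := `|s ^+ p|) _ acp) => z t _ _ _.
    by rewrite -scalerBr normrZ.
  have := abs_continuous_lin (-1) (acy ss0) acP.
  by apply: eq_abs_continuous => t _ _; rewrite scaleN1r.
have h : {ae mu, forall t, forall p : 'I_m.+1, a < t < b ->
    is_derive t 1 (jet_term p) (jet_rhs p t)}.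
  by apply: filter_forall => p; have [] := so p.
apply: filterS2 h (dy ss0) => t hp ht tab.
apply: is_deriveB; first exact: ht.
rewrite (_ : jet_poly m s = \sum_(p < m.+1) (s ^+ p \*: jet_term p)); last first.
  by apply/funext => z; rewrite fct_sumE.
apply: is_derive_sum => p; apply: is_deriveZ; exact: hp.
Qed.

Lemma rhs_integrable s i : `|s| < s0 ->
  integrable ((fun t => rhs s t 0 i) \_ `[a, b]).
Proof.
move=> ss0.
have -> : (fun t => rhs s t 0 i) = (fun t => \sum_(j <- index_enum 'I_l)
    (\sum_(r < k.+1) s ^+ r * g r j t) * f j (y s t) 0 i).
  by apply/funext => t; rewrite /rhs summxE; apply: eq_bigr => j _; rewrite mxE.
apply: integrable_cut_sum => j; apply: integrable_cut.
  by apply: integrable_sumr => r; exact: integrable_scaler.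
apply/subspace_continuousP => t /=; rewrite in_itv /= => /andP[at_ tb].
have Ay : A (y s t).
  apply: ZA; rewrite -[y s t](subrKC (x t)); apply: xZ => //.
  by apply: le_trans (yx ss0 at_ tb) _; move: r0_gt0; lra.
have cy : {within `[a, b], continuous (y s)} by apply: abs_continuous_within; exact: acy.
have cyt : y s @ within `[a, b] (nbhs t) --> y s t.
  by move/subspace_continuousP : cy; apply; rewrite /= in_itv /= at_.
have cf : {for y s t, continuous (fun z => f j z 0 i)}.
  apply: (@continuous_comp _ _ _ (f j) (fun z : V => z 0 i)).
    exact/differentiable_continuous/(sf j [::]).
  exact: coord_continuous.
exact: cvg_comp cyt cf.
Qed.

Lemma control_norm_integrable : integrable control_norm.
Proof.
by apply: integrable_sumr => r; apply: integrable_sumr => i; exact: integrable_normr.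
Qed.

Lemma jet_rhs0 t : a <= t -> t <= b -> jet_rhs 0 t = rhs 0 t.
Proof.
move=> at_ tb; rewrite /jet_rhs (big_pred1 ord0) /=; last by move=> r; rewrite leqn0.
apply: eq_bigr => i _; rewrite jet_coef0 y0x// big_ord_recl expr0 mul1r big1 ?addr0//.
by move=> r _; rewrite /= expr0n /= mul0r.
Qed.

(** Order 0 is the equation of y at s = 0, where y coincides with x. *)
Lemma solved0 : solved 0.
Proof.
move=> i; have z0 : `|0 : R| < s0 by rewrite normr0.
have E : (fun t => jet_rhs 0 t 0 i) \_ `[a, b] = (fun t => rhs 0 t 0 i) \_ `[a, b].
  apply/funext => t; rewrite !patchE; case: ifP => //.
  by rewrite inE /= in_itv /= => /andP[at_ tb]; rewrite jet_rhs0.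
rewrite E; have ii := rhs_integrable i z0; split => // t at_ tb.
rewrite /= -!y0x//.
apply: (@abs_continuous_prim R (fun t => y 0 t 0 i)) => //.
  by apply: abs_continuous_coord; apply: abs_continuousS (acy z0).
apply: filterS (dy z0) => z hz /andP[az zt].
rewrite patchE ifT; last by rewrite inE /= in_itv /= ltW//= ltW// (lt_le_trans zt).
by apply: is_derive_coord; apply: hz; rewrite az (lt_le_trans zt).
Qed.

(** The jet is used only at time a, to bound the initial remainder; Gronwall's inequality, with
    inhomogeneous term |s|^(m+1), spreads the bound over [a, b]. The initial bound needs the jet to
    order m + 1, hence m < k. *)
Lemma remainder_le m (B : R) : (m < k)%N -> (forall p, (p <= m)%N -> solved p) ->
  0 <= B -> (forall j : 'I_k, (j < m)%N -> forall t, a <= t -> t <= b -> `|bb j t| <= B) ->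
  exists2 C : R, 0 <= C & exists2 s1 : R, 0 < s1 <= s0 & forall s t, `|s| < s1 ->
    a <= t -> t <= b -> `|y s t - jet_poly m s t| <= C * `|s| ^+ m.+1.
Proof.
move=> mk sm B0 hB.
have [C C0 [s1 /andP[s10 s1s0] hC]] := rhs_expansion (ltnW mk) B0 hB.
have [d d0 hd] := jet_le mk (lexx a) ab ltr01.
(* In order: the remainder of order m + 1 at a, the term of order m + 1 at a, and the inhomogeneous
   term of Gronwall's inequality. *)
pose D := 1 + `|jet_term m.+1 a| + 1.
pose E := expR (C * (prim control_norm b - prim control_norm a)).
have D0 : 0 <= D by rewrite !addr_ge0.
have E0 : 0 <= E by exact: expR_ge0.
exists (D * E); first by rewrite mulr_ge0.
exists (Num.min s1 d); first by rewrite lt_min s10 d0 ge_min s1s0.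
move=> s t; rewrite lt_min => /andP[ss1 sd] at_ tb.
have ss0 : `|s| < s0 by exact: lt_le_trans s1s0.
have [acr dr] := remainder_ode ss0 sm.
have sm0 : 0 <= `|s| ^+ m.+1 by rewrite exprn_ge0.
have := gronwall ab acr dr control_norm_integrable control_norm_ge0 C0 sm0 _ at_ tb.
rewrite -/E => h.
have {}h : `|y s t - jet_poly m s t| + `|s| ^+ m.+1 <=
    (`|y s a - jet_poly m s a| + `|s| ^+ m.+1) * E.
  by apply: h => z /andP[az zb]; exact: hC.
have ha : `|y s a - jet_poly m s a| <= (1 + `|jet_term m.+1 a|) * `|s| ^+ m.+1.
  have -> : y s a - jet_poly m s a =
      (y s a - jet_poly m.+1 s a) + s ^+ m.+1 *: jet_term m.+1 a.
    by rewrite /jet_poly [in RHS]big_ord_recr /= opprD addrA subrK.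
  apply: (le_trans (ler_normD _ _)); apply: (le_trans (lerD (hd s sd) (lexx _))).
  by rewrite normrZ normrX [`|s| ^+ m.+1 * `|_| ]mulrC -mulrDl.
apply: (@le_trans _ _ (`|y s t - jet_poly m s t| + `|s| ^+ m.+1)); first by rewrite lerDl.
apply: (le_trans h); rewrite mulrAC; apply: ler_wpM2r => //.
by rewrite /D mulrDl mul1r lerD2r.
Qed.

(** The term of order m + 1 is the difference of the remainders of orders m and m + 1. The second
    one is o(s^(m+1)) at each t, so the uniform constant C of the first survives division by
    |s|^(m+1). *)
Lemma jet_term_le m (C s1 : R) : (m < k)%N -> 0 < s1 ->
  (forall s t, `|s| < s1 ->
    a <= t -> t <= b -> `|y s t - jet_poly m s t| <= C * `|s| ^+ m.+1) ->
  forall t, a <= t -> t <= b -> `|jet_term m.+1 t| <= C.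
Proof.
move=> mk s10 hC t at_ tb; apply/ler_addgt0Pr => e e0.
have [d d0 hd] := jet_le mk at_ tb e0.
pose s := Num.min d s1 / 2.
have m0 : 0 < Num.min d s1 by rewrite lt_min d0.
have sP : 0 < s by rewrite divr_gt0.
have ns : `|s| < Num.min d s1 by rewrite gtr0_norm// /s ltr_pdivrMr// ltr_pMr// ltr1n.
move: ns; rewrite lt_min => /andP[sd ss1].
have sm0 : 0 < `|s| ^+ m.+1 by rewrite exprn_gt0// gtr0_norm.
rewrite -(ler_pM2r sm0) mulrDl.
have := lerD (hC s t ss1 at_ tb) (hd s sd); apply: le_trans.
apply: le_trans (ler_normB _ _).
rewrite [leRHS](_ : _ = `|s ^+ m.+1 *: jet_term m.+1 t|); last first.
  by rewrite opprB addrC subrKA /jet_poly [X in `|X - _|]big_ord_recr /= addrAC subrr add0r.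
by rewrite [leRHS]normrZ normrX mulrC.
Qed.

(** The remainder divided by s^(m+1) is [q N], with derivative [dq N], along a sequence of values of
    s. The expansion of order m dominates [dq N] by a multiple of [control_norm]; the one of order m
    + 1, which relies on the new bound on b^(m+1), identifies its pointwise limit. *)
Lemma solved_step m (B : R) : (m < k)%N -> (forall p, (p <= m)%N -> solved p) ->
  0 <= B -> (forall j : 'I_k, (j < m)%N -> forall t, a <= t -> t <= b -> `|bb j t| <= B) ->
  solved m.+1 /\ exists2 C : R, 0 <= C &
    forall t, a <= t -> t <= b -> `|jet_term m.+1 t| <= C.
Proof.
move=> mk sm B0 hB.
have [C C0 [s1 /andP[s10 s1s0] hC]] := remainder_le mk sm B0 hB.
have tC := jet_term_le mk s10 hC.
split; last by exists C.
have [C1 C10 [s2 /andP[s20 s2s0] hC1]] := rhs_expansion (ltnW mk) B0 hB.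
have hB' (j : 'I_k) : (j < m.+1)%N -> forall t, a <= t -> t <= b -> `|bb j t| <= B + C.
  rewrite ltnS leq_eqVlt => /orP[/eqP jm|jm] t at_ tb; last first.
    by apply: le_trans (hB j jm t at_ tb) _; rewrite lerDl.
  have := tC t at_ tb; rewrite /= -jm valK => h.
  by apply: (le_trans h); rewrite lerDr.
have [C2 C20 [s3 /andP[s30 s3s0] hC2]] := rhs_expansion mk (addr_ge0 B0 C0) hB'.
pose sg := Num.min s1 (Num.min s2 s3).
have sg0 : 0 < sg by rewrite !lt_min s10 s20.
(* The denominator N + 2 keeps the values strictly below sg already for N = 0. *)
have [sigma sE] : exists sigma : nat -> R, sigma = fun N => sg / N.+2%:R by eexists.
have sigma_gt0 N : 0 < sigma N by rewrite sE divr_gt0.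
have sigma_lt N : `|sigma N| < sg.
  by rewrite gtr0_norm// sE ltr_pdivrMr// ltr_pMr// ltr1n.
have sigma_s1 N : `|sigma N| < s1 by apply: lt_le_trans (sigma_lt N) _; rewrite ge_min lexx.
have sigma_s2 N : `|sigma N| < s2.
  by apply: lt_le_trans (sigma_lt N) _; rewrite !ge_min lexx orbT.
have sigma_s3 N : `|sigma N| < s3.
  by apply: lt_le_trans (sigma_lt N) _; rewrite !ge_min lexx !orbT.
have sigma_s0 N : `|sigma N| < s0 by exact: lt_le_trans (sigma_s1 N) s1s0.
have sigma_near (d : R) : 0 < d -> \forall N \near \oo, `|sigma N| < d.
  move=> d0; have d1 : 0 < d / sg by rewrite divr_gt0.
  near=> N; rewrite gtr0_norm// sE mulrC -ltr_pdivlMr//.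
  have : N.+1%:R^-1 < d / sg by near: N; exact: (near_infty_natSinv_lt (PosNum d1)).
  by apply: lt_trans; rewrite ltf_pV2 ?posrE// ltr_nat.
pose c N := (`|sigma N| ^+ m.+1)^-1.
have c0 N : 0 < c N by rewrite invr_gt0 exprn_gt0// normr_gt0 gt_eqF.
have cK N : c N * `|sigma N| ^+ m.+1 = 1.
  by rewrite mulVf// gt_eqF// exprn_gt0// normr_gt0 gt_eqF.
have cs N (v : V) : c N *: (sigma N ^+ m.+1 *: v) = v.
  by have := cK N; rewrite gtr0_norm// scalerA => ->; rewrite scale1r.
pose q N t : V := c N *: (y (sigma N) t - jet_poly m (sigma N) t).
pose dq N t : V := c N *: (rhs (sigma N) t -
  \sum_(p < m.+1) sigma N ^+ p *: jet_rhs p t).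
have q_cvg t i : a <= t -> t <= b -> (fun N => q N t 0 i) @ \oo --> jet_term m.+1 t 0 i.
  move=> at_ tb; apply/cvgrPdist_le => e e0.
  have [d d0 hd] := jet_le mk at_ tb e0.
  near=> N; have sd : `|sigma N| < d by near: N; exact: sigma_near.
  have -> : jet_term m.+1 t 0 i - q N t 0 i =
      (- (c N *: (y (sigma N) t - jet_poly m.+1 (sigma N) t))) 0 i.
    rewrite /jet_poly big_ord_recr /= opprD addrA scalerBr cs opprB.
    by rewrite [RHS]mxE [in RHS]mxE.
  apply: (le_trans (normr_coord _ i)); rewrite normrN normrZ gtr0_norm//.
  apply: le_trans (ler_wpM2l (ltW (c0 N)) (hd _ sd)) _.
  by rewrite mulrCA cK mulr1.
have dq_le N t : a <= t -> t <= b -> `|dq N t| <= C1 * (C + 1) * control_norm t.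
  move=> at_ tb; rewrite normrZ gtr0_norm//.
  apply: le_trans (ler_wpM2l (ltW (c0 N)) (hC1 _ t (sigma_s2 N) at_ tb)) _.
  have h : `|y (sigma N) t - jet_poly m (sigma N) t| + `|sigma N| ^+ m.+1 <=
      (C + 1) * `|sigma N| ^+ m.+1 by rewrite mulrDl mul1r lerD2r; exact: hC.
  have w0 : 0 <= C1 * control_norm t by rewrite mulr_ge0 ?control_norm_ge0.
  have := ler_wpM2l w0 h; move/(ler_wpM2l (ltW (c0 N))) => h2; apply: (le_trans h2).
  rewrite mulrCA (mulrCA (c N)) cK mulr1; rewrite le_eqVlt; apply/orP; left; apply/eqP; ring.
have dq_cvg t i : a <= t -> t <= b -> (fun N => dq N t 0 i) @ \oo --> jet_rhs m.+1 t 0 i.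
  move=> at_ tb; apply/cvgrPdist_le => e e0.
  pose K := C2 * control_norm t; have K0 : 0 <= K by rewrite mulr_ge0 ?control_norm_ge0.
  (* The factor 2 counts the remainder of order m + 1 and the extra factor |s| in |s|^(m+2); the
     term 1 covers the case K = 0. *)
  pose e' := e / (2 * (K + 1)).
  have e'0 : 0 < e' by rewrite divr_gt0// mulr_gt0// ltr_wpDl.
  have [d d0 hd] := jet_le mk at_ tb e'0.
  near=> N; have sd : `|sigma N| < d by near: N; exact: sigma_near.
  have se : `|sigma N| < e' by near: N; exact: sigma_near.
  have -> : jet_rhs m.+1 t 0 i - dq N t 0 i =
      (- (c N *: (rhs (sigma N) t - \sum_(p < m.+2) sigma N ^+ p *: jet_rhs p t))) 0 i.
    rewrite big_ord_recr /= opprD addrA scalerBr cs opprB.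
    by rewrite [RHS]mxE [in RHS]mxE.
  apply: (le_trans (normr_coord _ i)); rewrite normrN normrZ gtr0_norm//.
  apply: le_trans (ler_wpM2l (ltW (c0 N)) (hC2 _ t (sigma_s3 N) at_ tb)) _.
  rewrite -/K.
  have h : `|y (sigma N) t - jet_poly m.+1 (sigma N) t| + `|sigma N| ^+ m.+2 <=
      (2 * e') * `|sigma N| ^+ m.+1.
    rewrite mulrDl mulrDl mul1r; apply: lerD; first exact: hd.
    by rewrite exprS; apply: ler_wpM2r; [rewrite exprn_ge0|exact: ltW].
  apply: le_trans (ler_wpM2l (ltW (c0 N)) (ler_wpM2l K0 h)) _.
  rewrite mulrCA (mulrCA (c N)) cK mulr1 /e'.
  have K1 : 0 < K + 1 by rewrite ltr_wpDl.
  have -> : K * (2 * (e / (2 * (K + 1)))) = e * (K / (K + 1)) by field; rewrite gt_eqF.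
  by rewrite ler_piMr ?(ltW e0)// ler_pdivrMr// mul1r lerDl.
move=> i.
pose phi N : R -> R := (fun t => dq N t 0 i) \_ `[a, b].
pose G : R -> R := (fun t => jet_rhs m.+1 t 0 i) \_ `[a, b].
pose K t := C1 * (C + 1) * control_norm t.
have iphi N : integrable (phi N).
  (* The trajectory term is placed at the last index, so that a single finite sum of integrable
     functions is left. *)
  have -> : phi N = (fun t => c N * (\sum_(p < m.+2) if p == ord_max then rhs (sigma N) t 0 i
      else - sigma N ^+ p * jet_rhs p t 0 i)) \_ `[a, b].
    congr (_ \_ _); apply/funext => t; rewrite /dq mxE; congr (_ * _).
    rewrite mxE [X in _ + X]mxE [RHS]big_ord_recr eqxx [RHS]addrC; congr (_ + _).
    rewrite summxE -sumrN.
    apply: eq_bigr => p _; rewrite ifF; first by rewrite mxE mulNr.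
    by apply/negbTE; rewrite -val_eqE /= neq_ltn ltn_ord.
  apply/integrable_cut_scale/integrable_cut_sum => p.
  case: eqVneq => [_|pm]; first exact: rhs_integrable.
  apply: integrable_cut_scale.
  have pm' : (p <= m)%N.
    by have := ltn_ord p; rewrite ltnS leq_eqVlt => /orP[/eqP h|//];
      case/eqP: pm; apply/val_inj.
  by have [] := sm p pm' i.
have iK : integrable K by apply: integrable_scaler; exact: control_norm_integrable.
have K0 t : 0 <= K t by rewrite mulr_ge0 ?control_norm_ge0// mulr_ge0// addr_ge0.
have phi_cvg t : phi ^~ t @ \oo --> G t.
  rewrite /phi /G; under eq_fun do rewrite patchE; rewrite patchE.
  case: ifPn => [|_]; last exact: cvg_cst.
  by rewrite inE /= in_itv /= => /andP[at_ tb]; exact: dq_cvg.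
have phi_le N t : `|phi N t| <= K t.
  rewrite /phi patchE; case: ifPn => [|_]; last by rewrite normr0.
  rewrite inE /= in_itv /= => /andP[at_ tb].
  by apply: le_trans (normr_coord _ i) _; exact: dq_le.
have [iG cG] := prim_dominated_cvg iphi iK phi_cvg phi_le.
split => // t at_ tb.
have h1 := cG a t at_.
have h2 : (fun N => q N t 0 i - q N a 0 i) @ \oo --> jet_term m.+1 t 0 i - jet_term m.+1 a 0 i.
  by apply: cvgB; apply: q_cvg.
have E : (fun N => prim (phi N) t - prim (phi N) a) = (fun N => q N t 0 i - q N a 0 i).
  apply/funext => N; apply/esym.
  have [acr dr] := remainder_ode (sigma_s0 N) sm.
  apply: (@abs_continuous_prim R (fun z => q N z 0 i)) => //.
    apply: abs_continuous_coord; apply: abs_continuousS (lexx a) tb _.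
    apply: (abs_continuous_comp1 (L := `|c N|) _ acr) => z z' _ _ _.
    by rewrite /q -scalerBr normrZ.
  apply: filterS dr => z hz /andP[az zt].
  rewrite /phi patchE ifT; last by rewrite inE /= in_itv /= ltW//= ltW// (lt_le_trans zt).
  apply: is_derive_coord; apply: is_deriveZ; apply: hz.
  by rewrite az (lt_le_trans zt).
rewrite E in h1; exact: (cvg_unique _ h2 h1).
Unshelve. all: by end_near. Qed.

Lemma solved_all m : (m <= k)%N -> (forall p, (p <= m)%N -> solved p) /\
  exists2 B : R, 0 <= B &
    forall j : 'I_k, (j < m)%N -> forall t, a <= t -> t <= b -> `|bb j t| <= B.
Proof.
elim: m => [_|m IH mk].
  by split; [move=> p; rewrite leqn0 => /eqP ->; exact: solved0|exists 0].
have [sm [B B0 hB]] := IH (ltnW mk).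
have [sm1 [C C0 hC]] := solved_step mk sm B0 hB; split.
  by move=> p; rewrite leq_eqVlt => /orP[/eqP ->//|]; exact: sm.
exists (B + C); first exact: addr_ge0.
move=> j; rewrite ltnS leq_eqVlt => /orP[/eqP jm|jm] t at_ tb; last first.
  by apply: le_trans (hB j jm t at_ tb) _; rewrite lerDl.
have := hC t at_ tb; rewrite /= -jm valK => h.
by apply: (le_trans h); rewrite lerDr.
Qed.

Theorem jet_ode (j : 'I_k) : abs_continuous a b (bb j) /\
  {ae mu, forall t, a < t < b -> is_derive t 1 (bb j) (jet_rhs j.+1 t)}.
Proof.
have [sk _] := solved_all (leqnn k).
have E : jet_term j.+1 = bb j by apply/funext => t; rewrite /= valK.
by have := solved_ode (sk j.+1 (ltn_ord j)); rewrite E.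
Qed.

End JetOde.

(** * Integrability of the controls *)

Section Controls.
Variable R : realType.
Local Notation mu := (@lebesgue_measure R).
Local Notation integrable g := (mu.-integrable setT (EFin \o g)).

Lemma chain_widenl (a a' : R) s b : a' <= a -> chain a s b -> chain a' s b.
Proof.
move=> aa; elim: s b => [|p s IH] b /=; first exact: le_trans.
by move=> [/IH].
Qed.

Lemma det_cvg (T : Type) (F : set_system T) (m : nat) (N : T -> 'M[R]_m) (L : 'M[R]_m) :
  Filter F -> (forall i j, (fun t => N t i j) @ F --> L i j) ->
  (fun t => \det (N t)) @ F --> \det L.
Proof.
move=> FF h; rewrite /determinant; apply: cvg_big => [|s _]; first exact: add_continuous.
apply: cvgM; first exact: cvg_cst.
by apply: cvg_big => [|i _]; [exact: mul_continuous|exact: h].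
Qed.

(** Through the adjugate, continuity of the inverse reduces to that of determinants. *)
Lemma invmx_cvg (T : Type) (F : set_system T) (m : nat) (N : T -> 'M[R]_m) (L : 'M[R]_m) :
  Filter F -> (forall i j, (fun t => N t i j) @ F --> L i j) -> \det L != 0 ->
  forall i j, (fun t => ((\det (N t))^-1 *: \adj (N t)) i j) @ F -->
    ((\det L)^-1 *: \adj L) i j.
Proof.
move=> FF h d0 i j; rewrite mxE; under eq_fun do rewrite mxE.
apply: cvgM; first by apply: cvgV => //; exact: det_cvg.
rewrite mxE /cofactor; under eq_fun do rewrite mxE /cofactor.
apply: cvgM; first exact: cvg_cst.
apply: det_cvg => i' j'; rewrite !mxE; under eq_fun do rewrite !mxE; exact: h.
Qed.

Lemma integrable_restrict_set (D : set R) (h : R -> R) : measurable D ->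
  integrable h -> integrable (h \_ D).
Proof.
move=> mD ih; have -> : EFin \o (h \_ D) = (EFin \o h) \_ D by rewrite restrict_EFin.
by apply: (integrable_mkcond _ _).1 => //; exact: integrable_sub.
Qed.

Lemma integrable_glue (a y z : R) (h1 h2 v : R -> R) :
  integrable h1 -> integrable h2 ->
  {ae mu, forall t, a < t < y -> h1 t = v t} ->
  {ae mu, forall t, y < t < z -> h2 t = v t} ->
  exists2 h, integrable h & {ae mu, forall t, a < t < z -> h t = v t}.
Proof.
move=> i1 i2 e1 e2.
exists (fun t => (h1 \_ `]-oo, y[) t + (h2 \_ `[y, +oo[) t).
  have := integrableD measurableT (integrable_restrict_set (measurable_itv `]-oo, y[) i1)
    (integrable_restrict_set (measurable_itv `[y, +oo[) i2).
  by apply: eq_integrable.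
have ey : {ae mu, forall t, t != y}.
  exists [set y]; split; [exact: measurable_set1|exact: lebesgue_measure_set1|].
  by move=> t /= /negP; rewrite negbK => /eqP.
apply: filterS3 e1 e2 ey => t ht1 ht2 ty /andP[at_ tz].
rewrite !patchE; have [tly|ylt] := ltP t y.
  rewrite ifT ?inE /= ?in_itv//= ifF ?addr0; first by apply: ht1; rewrite at_.
  by apply/negP; rewrite inE /= in_itv /= andbT leNgt tly.
rewrite ifF ?add0r; last by apply/negP; rewrite inE /= in_itv /= ltNge ylt.
rewrite ifT; last by rewrite inE /= in_itv /= ylt.
by apply: ht2; rewrite tz andbT lt_neqAle eq_sym ty.
Qed.

Section LocalControl.
Variables (n l : nat).

(* v = x' B (N B)^-1. *)
Lemma local_control_integrable (y z : R) (x : R -> 'rV[R]_n) (v : R -> 'rV[R]_l)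
    (N : R -> 'M[R]_(l, n)) (B : 'M[R]_(n, l)) :
  y < z -> abs_continuous y z x ->
  (exists w : R -> R, forall y' z', y <= y' -> y' <= z' -> z' <= z ->
    `|x z' - x y'| <= w z' - w y') ->
  {ae mu, forall t, y < t < z -> is_derive t 1 x (v t *m N t)} ->
  (forall i j, {within `[y, z], continuous (fun t => N t i j)}) ->
  (forall t, y <= t -> t <= z -> \det (N t *m B) != 0) ->
  forall i, exists2 h, integrable h & {ae mu, forall t, y < t < z -> h t = v t 0 i}.
Proof.
move=> yz acx [w hw] dx cN dN i.
have hk (k : 'I_n) : exists h, integrable h /\
    {ae mu, forall t, y < t < z -> h t = (v t *m N t) 0 k}.
  have [||| h ih eh] := @derive_integrable R (fun t => x t 0 k) (fun t => (v t *m N t) 0 k) y z yz.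
  - exists w => y' z' h1 h2 h3; apply: le_trans (hw y' z' h1 h2 h3).
    by apply: le_trans (normr_coord (x z' - x y') k); rewrite !mxE.
  - exact: abs_continuous_coord.
  - by apply: filterS dx => t ht tyz; apply: is_derive_coord; exact: ht.
  - by exists h.
have /fin_all_exists[h hh] := hk.
pose phi k t := (B *m ((\det (N t *m B))^-1 *: \adj (N t *m B))) k i.
have cphi k : {within `[y, z], continuous (phi k)}.
  have -> : phi k = fun t => \sum_j B k j * ((\det (N t *m B))^-1 *: \adj (N t *m B)) j i.
    by apply/funext => t; rewrite /phi mxE.
  apply/subspace_continuousP => t tyz.
  apply: cvg_big => [|j _]; first exact: add_continuous.
  apply: cvgM; first exact: cvg_cst.
  apply: invmx_cvg; last by move: tyz; rewrite /= in_itv /= => /andP[yt tz]; exact: dN.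
  move=> i' j'; rewrite mxE; under eq_fun do rewrite mxE.
  apply: cvg_big => [|k' _]; first exact: add_continuous.
  apply: cvgM; last exact: cvg_cst.
  by have /subspace_continuousP/(_ t tyz) := cN i' k'.
exists ((fun t => \sum_k h k t * phi k t) \_ `[y, z]).
  by apply: integrable_cut_sum => k; apply: integrable_cut => //; exact: (hh k).1.
have ek : {ae mu, forall t, forall k : 'I_n, y < t < z -> h k t = (v t *m N t) 0 k}.
  by apply: filter_forall => k; exact: (hh k).2.
apply: filterS ek => t ht /[dup] tyz /andP[yt tz].
rewrite patchE ifT; last by rewrite inE /= in_itv /= !ltW.
under eq_bigr do rewrite ht//.
have -> : \sum_k (v t *m N t) 0 k * phi k t =
  (v t *m N t *m (B *m ((\det (N t *m B))^-1 *: \adj (N t *m B)))) 0 i by rewrite [RHS]mxE.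
rewrite -mulmxA (mulmxA (N t)) -scalemxAr mul_mx_adj.
rewrite scale_scalar_mx mulVf ?mulmx1//; apply: dN; exact: ltW.
Qed.

End LocalControl.

(** Real induction on [0, T] glues local results. Near t0 a single chart is used, and a right
    inverse B of the matrix [N t0] of the fields is kept constant, [N t *m B] staying invertible by
    continuity of the determinant. *)
Lemma trajectory_control_integrable (n l : nat) (M : smooth_manifold R n)
    (X : 'I_l -> vector_field M) (T : R) (q0 : M) (v : R -> 'rV[R]_l) (q : R -> M) :
  pointwise_independent X -> 0 < T -> trajectory X T q0 v q ->
  forall i, exists2 h, integrable h & {ae mu, forall t, 0 < t < T -> h t = v t 0 i}.
Proof.
move=> Xind T0 [cq _ hq] i.
apply: (@cousin_ind R 0 T (fun t => exists2 h, integrable h &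
  {ae mu, forall t', 0 < t' < t -> h t' = v t' 0 i})); first exact: ltW.
  exists (fun=> 0); first exact: integrable0.
  by apply: aeW => t /andP[h1 h2]; have := lt_trans h1 h2; rewrite ltxx.
move=> t0 t00 t0T.
have [c ac cqt0] := atlas_cover (q t0).
have t0I : `[0, T]%classic t0 by rewrite /= in_itv /= t00.
have cqt t : 0 <= t -> t <= T -> q @ within `[0, T] (nbhs t) --> q t.
  by move=> h1 h2; move/subspace_continuousP : cq; apply; rewrite /= in_itv /= h1.
have [d1 /= d10 hd1] : \forall t \near t0, `[0, T]%classic t -> chart_dom c (q t).
  have : \forall t \near within `[0, T] (nbhs t0), chart_dom c (q t).
    by apply: (cqt t0 t00 t0T); apply: open_nbhs_nbhs; split => //; exact: chart_dom_open.
  by rewrite near_withinE => /nbhs_ballP.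
pose y0 := Num.max 0 (t0 - d1 / 2); pose z0 := Num.min T (t0 + d1 / 2).
have hdom t : y0 <= t -> t <= z0 -> chart_dom c (q t).
  rewrite ge_max le_min => /andP[h1 h2] /andP[h3 h4]; apply: hd1.
    by apply: ball_oo; lra.
  by rewrite /= in_itv /= h1.
pose x t := chart_map c (q t).
have sub y z : y0 <= y -> z <= z0 -> caratheodory `[y, z] x
    (fun t => \sum_(j < l) v t 0 j *: X j c (x t)).
  move=> yy zz; apply: (hq c `[y, z]%classic ac).
  - exact: interval_is_interval.
  - move=> t /=; rewrite !in_itv /= => /andP[yt tz].
    move: (le_trans yy yt) (le_trans tz zz); rewrite ge_max le_min.
    by move=> /andP[-> _] /andP[-> _].
  - move=> _ [t tyz <-]; move: tyz; rewrite /= in_itv /= => /andP[yt tz].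
    by apply: hdom; [exact: le_trans yt|exact: le_trans zz].
have y0z0 : y0 <= z0.
  by rewrite ge_max !le_min; apply/andP; split; apply/andP; split; lra.
have [acx0 _] := sub y0 z0 (lexx _) (lexx _).
have {}acx0 := acx0 y0 z0 y0z0 (@subset_refl _ _).
have [d2 d20 hd2] := abs_continuous_chain acx0 ltr01.
pose N t := \matrix_(j < l) X j c (x t).
have cN t j k : 0 <= t -> t <= T -> chart_dom c (q t) ->
    (fun t' => N t' j k) @ within `[0, T] (nbhs t) --> N t j k.
  move=> h0 hT ct; rewrite mxE.
  rewrite (_ : (fun t' => N t' j k) = (fun p : 'rV[R]_n => p 0 k) \o (X j c \o x));
    last by apply/funext => t'; rewrite /N /= mxE.
  have h1 : x @ within `[0, T] (nbhs t) --> x t.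
    exact: cvg_comp (cqt t h0 hT) (chart_map_continuous ct).
  have h2 : {for x t, continuous (X j c)}.
    apply: differentiable_continuous; apply: (@field_smooth _ _ _ (X j) _ ac [::]).
    by exists (q t).
  have h3 := @coord_continuous R 1 n 0 k (X j c (x t)).
  have h12 : X j c \o x @ within `[0, T] (nbhs t) --> X j c (x t) by exact: cvg_comp h1 h2.
  exact: cvg_comp h12 h3.
have cdet (B : 'M[R]_(n, l)) t : 0 <= t -> t <= T -> chart_dom c (q t) ->
    (fun t' => \det (N t' *m B)) @ within `[0, T] (nbhs t) --> \det (N t *m B).
  move=> h0 hT ct; apply: det_cvg => j k; rewrite mxE; under eq_fun do rewrite mxE.
  apply: cvg_big => [|k' _]; first exact: add_continuous.
  by apply: cvgM; [exact: cN|exact: cvg_cst].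
have /row_freeP[B NB] : row_free (N t0) by exact: Xind.
have [d3 /= d30 hd3] : \forall t \near t0, `[0, T]%classic t -> \det (N t *m B) != 0.
  have h : \forall d \near \det (N t0 *m B), d != 0.
    by apply: open_nbhs_nbhs; split; [exact: open_neq|rewrite NB det1 /= oner_neq0].
  have h' : \forall t \near within `[0, T] (nbhs t0), \det (N t *m B) != 0.
    exact: (cdet B t0 t00 t0T cqt0 _ h).
  by move: h'; rewrite near_withinE => /nbhs_ballP.
(* Here d1 keeps the trajectory in the chart, d2 is the modulus of absolute continuity for
   increments below 1, halved so that z - y < d2, and d3 keeps [N t *m B] invertible. *)
exists (Num.min (d1 / 2) (Num.min (d2 / 2) d3)); first by rewrite !lt_min d30 !divr_gt0.
move=> y z y00 hy yt0 t0z hz zT [h1 ih1 eh1].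
have [yz|zy] := ltP y z; last first.
  have -> : z = y by apply: le_anti; rewrite zy (le_trans yt0 t0z).
  by exists h1.
have [h2 ih2 eh2] : exists2 h, integrable h & {ae mu, forall t, y < t < z -> h t = v t 0 i}.
  have [hy1 [hy2 hy3]] : t0 - d1 / 2 < y /\ t0 - d2 / 2 < y /\ t0 - d3 < y.
    move: hy; rewrite ltrBlDr -ltrBlDl !lt_min => /andP[? /andP[? ?]].
    by split; [|split]; rewrite ltrBlDr -ltrBlDl.
  have [hz1 [hz2 hz3]] : z < t0 + d1 / 2 /\ z < t0 + d2 / 2 /\ z < t0 + d3.
    move: hz; rewrite -ltrBlDl !lt_min => /andP[? /andP[? ?]].
    by split; [|split]; rewrite -ltrBlDl.
  have yy0 : y0 <= y by rewrite ge_max y00 ltW.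
  have zz0 : z <= z0 by rewrite le_min zT ltW.
  have [acx dx] := sub y z yy0 zz0.
  apply: (@local_control_integrable n l y z x v N B yz) => //.
  - exact: acx (ltW yz) (@subset_refl _ _).
  - apply: (@variation_majorant _ _ _ _ d2); last by move: hy2 hz2; clear; lra.
    move=> s cs; apply: hd2; apply: chain_widen zz0.
    by apply: chain_widenl cs.
  - apply: filterS dx => t ht tyz; have {}ht := ht _.
    have -> : v t *m N t = \sum_(j < l) v t 0 j *: X j c (x t).
      by rewrite mulmx_sum_row; apply: eq_bigr => j _; rewrite /N rowK.
    by apply: ht; move: tyz => /andP[? ?]; rewrite /= in_itv /= !ltW.
  - move=> j k; apply/subspace_continuousP => t /=; rewrite in_itv /= => /andP[yt tz].
    have h : (fun t' => N t' j k) @ within `[0, T] (nbhs t) --> N t j k.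
      apply: cN; [exact: le_trans yt|exact: le_trans zT|].
      by apply: hdom; [exact: le_trans yt|exact: le_trans zz0].
    apply: (cvg_trans _ h); apply: cvg_app; apply: within_subset.
    exact: subset_cc.
  - move=> t yt tz; apply: hd3.
      by apply: ball_oo; [exact: lt_le_trans yt|exact: le_lt_trans hz3].
    by apply: (subset_cc y00 zT); rewrite /= in_itv /= yt.
exact: integrable_glue ih1 ih2 eh1 eh2.
Qed.

End Controls.

(** * Trajectories near the reference trajectory *)

Section StayInTube.
Variables (R : realType) (n : nat) (M : smooth_manifold R n) (c : chart R n M).

Lemma chart_cvg (T : R) (q : R -> M) (t : R) : {within `[0, T], continuous q} ->
  0 <= t -> t <= T -> chart_dom c (q t) ->
  (chart_map c \o q) @ within `[0, T] (nbhs t) --> chart_map c (q t).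
Proof.
move=> /subspace_continuousP cq h1 h2 ct.
have h : q @ within `[0, T] (nbhs t) --> q t by apply: cq; rewrite /= in_itv /= h1.
exact: cvg_comp h (chart_map_continuous ct).
Qed.

(* At a first exit time t0, q' t0 is a limit of points of the image by
   [chart_inv c] of a compact ball. This image is closed because M is Hausdorff,
   so q' t0 is still in the domain of the chart. *)
Lemma stay_in_tube (T a b r : R) (q q' : R -> M) :
  0 < r -> 0 <= a -> b <= T -> a <= b ->
  {within `[0, T], continuous q} -> {within `[0, T], continuous q'} ->
  (forall t, a <= t -> t <= b -> chart_dom c (q t)) ->
  (forall t, a <= t -> t <= b -> forall h, `|h| <= r ->
    (chart_map c @` chart_dom c) (chart_map c (q t) + h)) ->
  chart_dom c (q' a) -> `|chart_map c (q' a) - chart_map c (q a)| <= r / 8 ->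
  (forall t, a <= t -> t <= b ->
    (forall t', a <= t' -> t' <= t -> chart_dom c (q' t') /\
       `|chart_map c (q' t') - chart_map c (q t')| <= r / 4) ->
    `|chart_map c (q' t) - chart_map c (q t)| <= r / 8) ->
  forall t, a <= t -> t <= b -> chart_dom c (q' t) /\
    `|chart_map c (q' t) - chart_map c (q t)| <= r / 4.
Proof.
move=> r0 a0 bT ab cq cq' qdom tube dom_a dist_a gron.
pose x t := chart_map c (q t); pose y t := chart_map c (q' t).
pose P t := forall t', a <= t' -> t' <= t -> chart_dom c (q' t') /\ `|y t' - x t'| <= r / 4.
suff Pb : P b by move=> t at_ tb; exact: Pb.
have cx t : a <= t -> t <= b -> x @ within `[0, T] (nbhs t) --> x t.
  by move=> h1 h2; apply: chart_cvg => //; [exact: le_trans h1|exact: le_trans bT|exact: qdom].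
apply: (@cousin_ind R a b P ab).
  move=> t' h1 h2; have -> : t' = a by apply: le_anti; rewrite h1 h2.
  by split => //; apply: le_trans dist_a _; lra.
move=> t0 at0 t0b.
(* If P already fails at some z < t0, no starting point beyond z satisfies P, and the step is
   vacuous. *)
have [Plt|] := pselect (forall z, a <= z -> z < t0 -> P z); last first.
  move=> /existsNP[z /not_implyP[az /not_implyP[zt0 nPz]]].
  exists (t0 - z); first by rewrite subr_gt0.
  move=> y' z' _ h1 _ _ _ _ Py; exfalso; apply: nPz => t' h2 h3; apply: Py => //.
  by apply: (le_trans h3); move: h1; rewrite subKr => /ltW.
have Plt8 z : a <= z -> z < t0 -> chart_dom c (q' z) /\ `|y z - x z| <= r / 8.
  move=> az zt0; split; first by have [] := Plt z az zt0 z az (lexx _).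
  by apply: gron => //; [exact: le_trans (ltW zt0) t0b|exact: Plt].
have r8 : 0 < r / 32 by lra.
(* The limit at t0 costs twice r / 32 over the improved bound r / 8. A further loss of twice r / 64
   just after t0 still stays below r / 4. *)
have [dom0 dist0] : chart_dom c (q' t0) /\ `|y t0 - x t0| <= r / 8 + r / 16.
  have [ta|ta] := eqVneq t0 a.
    by rewrite ta; split => //; apply: le_trans dist_a _; lra.
  have {}at0 : a < t0 by rewrite lt_neqAle eq_sym ta.
  have FL : ProperFilter t0^'- by exact: at_left_proper_filter.
  have left_within : t0^'- `=>` within `[0, T] (nbhs t0).
    move=> U; rewrite /within /= => /nbhs_ballP[e /= e0 he].
    near=> z; apply: he; last first.
      rewrite /= in_itv /=.
      have az : a <= z by apply/ltW; near: z; exact: nbhs_left_gt.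
      have zt0 : z < t0 by near: z; exact: nbhs_left_lt.
      by rewrite (le_trans a0 az) (le_trans (ltW zt0) (le_trans t0b bT)).
    near: z; apply: (@cvg_within _ (nbhs t0)); exact: nbhsx_ballx.
  have xl : x @ t0^'- --> x t0.
    apply: cvg_trans (cx t0 (ltW at0) t0b); exact: cvg_app.
  have ql : q' @ t0^'- --> q' t0.
    have h : q' @ within `[0, T] (nbhs t0) --> q' t0.
      move/subspace_continuousP : cq'; apply; rewrite /= in_itv /=.
      by rewrite (le_trans a0 (ltW at0)) (le_trans t0b bT).
    apply: cvg_trans h; exact: cvg_app.
  have near_l : \forall z \near t0^'-, a <= z /\ z < t0.
    near=> z; split; first by apply/ltW; near: z; exact: nbhs_left_gt.
    by near: z; exact: nbhs_left_lt.
  pose D := [set z : 'rV[R]_n | `|z - x t0| <= r / 4].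
  have DA : D `<=` chart_map c @` chart_dom c.
    move=> z Dz; rewrite -(subrKC (x t0) z); apply: tube => //; first exact: ltW.
    by apply: le_trans Dz _; lra.
  have cD : compact D by exact: closed_ball_compact.
  have clD : closed (chart_inv c @` D).
    apply: compact_closed; first exact: manifold_hausdorff.
    apply: continuous_compact => //; apply: continuous_in_subspaceT => z; rewrite inE => Dz.
    by apply: chart_inv_continuous; exact: DA.
  have q'D : (chart_inv c @` D) (q' t0).
    refine (@closed_cvg _ _ _ FL q' (chart_inv c @` D) clD _ _ ql).
    near=> z.
    have [az zt0] : a <= z /\ z < t0 by near: z.
    have [dz hz] := Plt8 z az zt0.
    exists (y z); last by rewrite /y chart_mapK.
    rewrite /D /= -(subrKA (x z)); apply: (le_trans (ler_normD _ _)).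
    have : `|x z - x t0| <= r / 8.
      rewrite distrC; near: z; move/cvgrPdist_le : xl; apply; lra.
    lra.
  have dom0 : chart_dom c (q' t0).
    case: q'D => z Dz <-; have [p dp <-] := DA z Dz; by rewrite chart_mapK.
  split => //.
  have yl : y @ t0^'- --> y t0.
    apply: cvg_trans (chart_cvg cq' _ _ dom0); [|exact: le_trans a0 (ltW at0)|exact: le_trans bT];
      exact: cvg_app.
  near t0^'- => z.
  have [az zt0] : a <= z /\ z < t0 by near: z.
  have [_ hz] := Plt8 z az zt0.
  have h1 : `|x t0 - x z| <= r / 32 by near: z; move/cvgrPdist_le : xl; apply.
  have h2 : `|y t0 - y z| <= r / 32 by near: z; move/cvgrPdist_le : yl; apply.
  rewrite -(subrKA (y z)) -[y z - x t0](subrKA (x z)).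
  apply: (le_trans (ler_normD _ _)).
  have := ler_normD (y z - x z) (x z - x t0); rewrite [`|x z - x t0|]distrC.
  by move: h1 h2 hz; clear; lra.
have cy := chart_cvg cq' (le_trans a0 at0) (le_trans t0b bT) dom0.
have [d /= d0 hd] : \forall t \near t0, `[0, T]%classic t ->
    chart_dom c (q' t) /\ `|y t - x t| <= r / 4.
  have h : \forall t \near within `[0, T] (nbhs t0),
      chart_dom c (q' t) /\ `|y t - x t| <= r / 4.
    have h1 : \forall t \near within `[0, T] (nbhs t0), chart_dom c (q' t).
      have hq : q' @ within `[0, T] (nbhs t0) --> q' t0.
        move/subspace_continuousP : cq'; apply; rewrite /= in_itv /=.
        by rewrite (le_trans a0 at0) (le_trans t0b bT).
      by apply: hq; apply: open_nbhs_nbhs; split => //; exact: chart_dom_open.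
    have h2 : \forall t \near within `[0, T] (nbhs t0), `|y t0 - y t| <= r / 64.
      by move/cvgrPdist_le : cy; apply; lra.
    have h3 : \forall t \near within `[0, T] (nbhs t0), `|x t0 - x t| <= r / 64.
      by move/cvgrPdist_le : (cx t0 at0 t0b); apply; lra.
    near=> z; split; first by near: z.
    have hy : `|y t0 - y z| <= r / 64 by near: z.
    have hx : `|x t0 - x z| <= r / 64 by near: z.
    rewrite -(subrKA (y t0)) -[y t0 - x z](subrKA (x t0)).
    apply: (le_trans (ler_normD _ _)); rewrite [`|y z - _|]distrC.
    have := ler_normD (y t0 - x t0) (x t0 - x z); move: hy hx dist0 r0; clear; lra.
  by move: h; rewrite near_withinE => /nbhs_ballP.
exists d => // z z' az zt0 zt1 tz tz' zb _ t' at' tz''.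
have [t't0|t0t'] := ltP t' t0; first by apply: (Plt t').
apply: hd.
  apply: ball_oo; last exact: le_lt_trans tz'.
  by apply: lt_le_trans t0t'; rewrite ltrBlDr ltrDl.
by apply: (subset_cc a0 bT); rewrite /= in_itv /= at' (le_trans tz'').
Unshelve. all: by end_near.
Qed.

End StayInTube.

Section LocalJet.
Variables (R : realType) (n l k : nat) (M : smooth_manifold R n).
Local Notation mu := (@lebesgue_measure R).
Local Notation integrable g := (mu.-integrable setT (EFin \o g)).

Lemma jet_control (u : R -> 'rV[R]_l) (Du : 'I_k -> R -> 'rV[R]_l) (s t : R) (i : 'I_l) :
  (u + jet_curve Du s) t 0 i =
  \sum_(r < k.+1) s ^+ r * control_of_order u Du r t 0 i.
Proof.
rewrite big_ord_recl expr0 mul1r /control_of_order unlift_none.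
rewrite addrfctE mxE; congr (_ + _).
rewrite /jet_curve fct_sumE summxE; apply: eq_bigr => j _.
by rewrite liftK mxE.
Qed.

(** The neighbourhood of s = 0 in [has_jet] depends on t. One neighbourhood valid on all of [a, b]
    is obtained from the jet at a alone, by Gronwall's inequality inside the tube. *)
Lemma local_jet_ode (X : 'I_l -> vector_field M) (T : R) (q0 : M)
    (u : R -> 'rV[R]_l) (Du : 'I_k -> R -> 'rV[R]_l) (q : R -> M) (Q : R -> R -> M)
    (c : chart R n M) (g : 'I_k.+1 -> 'I_l -> R -> R) (a b : R)
    (beta : 'I_k -> R -> 'rV[R]_n) :
  (0 < k)%N -> 0 <= a -> a < b -> b <= T -> atlas c ->
  trajectory X T q0 u q ->
  (forall s, trajectory X T q0 (u + jet_curve Du s) (Q s)) ->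
  (forall r i, integrable (g r i)) ->
  {ae mu, forall t, 0 < t < T -> forall r i, g r i t = control_of_order u Du r t 0 i} ->
  (forall t, a <= t -> t <= b -> chart_dom c (q t)) ->
  (forall t, a <= t -> t <= b ->
    has_jet c (fun s => Q s t) (chart_map c (q t)) (beta ^~ t)) ->
  forall m, abs_continuous a b (beta m) /\
    {ae mu, forall t, a < t < b -> is_derive t 1 (beta m)
      (jet_rhs (fun i => X i c) g (fun t => chart_map c (q t)) beta m.+1 t)}.
Proof.
move=> k0 a0 ab bT ac tq tQ ig eg qdom hjet.
pose x t := chart_map c (q t); pose y s t := chart_map c (Q s t).
pose A := chart_map c @` chart_dom c.
pose f i := X i c : 'rV[R]_n -> 'rV[R]_n.
have oA : open A by exact: chart_img_open.
have sf i : smooth_on A (f i) by exact: field_smooth.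
have [cq _ hq] := tq.
have cx : {within `[a, b], continuous x}.
  apply/subspace_continuousP => t /=; rewrite in_itv /= => /andP[at_ tb].
  have h : x @ within `[0, T] (nbhs t) --> x t.
    by apply: (chart_cvg cq); [exact: le_trans at_|exact: le_trans bT|exact: qdom].
  apply: (cvg_trans _ h); apply: cvg_app; apply: within_subset.
  exact: subset_cc.
have cK : compact (x @` `[a, b]).
  by apply: continuous_compact => //; exact: segment_compact.
have KA : x @` `[a, b] `<=` A.
  by move=> _ [t tab <-]; move: tab; rewrite /= in_itv /= => /andP[? ?]; exists (q t) => //; exact: qdom.
have [r [Z [r0 cZ ZA hZ]]] := compact_tube oA cK KA.
have r4r : r / 4 <= r by rewrite ler_pdivrMr// ler_peMr ?(ltW r0)// ler1n.
have xZ t : a <= t -> t <= b -> forall h, `|h| <= r -> Z (x t + h).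
  by move=> at_ tb h hr; apply: hZ => //; exists t => //=; rewrite in_itv /= at_.
have /fin_all_exists2[L L0 hL] := fun i => lipschitz_bound oA (sf i) cZ ZA.
have /fin_all_exists2[D D0 hD] := fun i => iter_diff_bounded 0 0 oA (sf i) cZ ZA.
(* One constant for both the Lipschitz bounds and the sup norms of the fields on Z. *)
pose C := \sum_i L i + \sum_i D i.
have sL : 0 <= \sum_i L i by exact: sumr_ge0.
have sD : 0 <= \sum_i D i by exact: sumr_ge0.
have C0 : 0 <= C by exact: addr_ge0.
have LC i : L i <= C by rewrite /C (bigD1 i)//= -addrA lerDl addr_ge0// sumr_ge0.
have DC i : D i <= C by rewrite /C addrC (bigD1 i)//= -addrA lerDl addr_ge0// sumr_ge0.
pose w := control_norm g.
have iw : integrable w by exact: control_norm_integrable.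
have w0 t : 0 <= w t by exact: control_norm_ge0.
pose rs s t := \sum_i (\sum_(r < k.+1) s ^+ r * g r i t) *: f i (y s t).
have ode s t : a <= t -> t <= b -> (forall t', a <= t' -> t' <= t -> chart_dom c (Q s t')) ->
    abs_continuous a t (y s) /\ {ae mu, forall t', a < t' < t -> is_derive t' 1 (y s) (rs s t')}.
  move=> at_ tb dQ; have [cQ _ /(_ c `[a, t]%classic ac)[]] := tQ s.
  - exact: interval_is_interval.
  - exact: subset_cc a0 (le_trans tb bT).
  - move=> _ [t' h <-]; move: h; rewrite /= in_itv /= => /andP[? ?]; exact: dQ.
  - move=> acs ds; split; first by apply: acs => //; exact: subset_refl.
    apply: filterS2 ds eg => t' hd he /andP[at' t't].
    have -> : rs s t' = \sum_(i < l) (u + jet_curve Du s) t' 0 i *: X i c (chart_map c (Q s t')).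
      apply: eq_bigr => i _; congr (_ *: _); rewrite jet_control.
      apply: eq_bigr => r' _; rewrite he//.
      by rewrite (le_lt_trans a0 at') (lt_le_trans t't (le_trans tb bT)).
    by apply: hd; rewrite /= in_itv /= !ltW.
have odex t : a <= t -> t <= b ->
    abs_continuous a t x /\ {ae mu, forall t', a < t' < t ->
      is_derive t' 1 x (\sum_i g ord0 i t' *: f i (x t'))}.
  move=> at_ tb; have [|||acs ds] := hq c `[a, t]%classic ac.
  - exact: interval_is_interval.
  - exact: subset_cc a0 (le_trans tb bT).
  - move=> _ [t' h <-]; move: h; rewrite /= in_itv /= => /andP[? ?]; apply: qdom => //.
    exact: le_trans tb.
  - split; first by apply: acs => //; exact: subset_refl.
    apply: filterS2 ds eg => t' hd he /andP[at' t't].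
    have -> : \sum_i g ord0 i t' *: f i (x t') = \sum_(i < l) u t' 0 i *: X i c (chart_map c (q t')).
      apply: eq_bigr => i _; congr (_ *: _).
      rewrite he; first by rewrite /control_of_order unlift_none.
      by rewrite (le_lt_trans a0 at') (lt_le_trans t't (le_trans tb bT)).
    by apply: hd; rewrite /= in_itv /= !ltW.
pose E := expR (C * (prim w b - prim w a)).
have E1 : 1 <= E.
  by rewrite -expR0 ler_expR mulr_ge0// subr_ge0; apply: prim_nondecreasing => //; exact: ltW.
have E0 : 0 < E by exact: expR_gt0.
have gron s t : `|s| <= 1 -> a <= t -> t <= b ->
    (forall t', a <= t' -> t' <= t -> chart_dom c (Q s t') /\ `|y s t' - x t'| <= r / 4) ->
    `|y s t - x t| <= (`|y s a - x a| + `|s|) * E.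
  move=> s1 at_ tb hyp.
  have [acy dy] := ode s t at_ tb (fun t' h1 h2 => (hyp t' h1 h2).1).
  have [acx dx] := odex t at_ tb.
  pose rho t := rs s t - \sum_i g ord0 i t *: f i (x t).
  have acr : abs_continuous a t (fun t => y s t - x t).
    have := abs_continuous_lin (-1) acy acx.
    by apply: eq_abs_continuous => t' _ _; rewrite scaleN1r.
  have dr : {ae mu, forall t', a < t' < t -> is_derive t' 1 (fun t => y s t - x t) (rho t')}.
    by apply: filterS2 dy dx => t' h1 h2 h3; apply: is_deriveB; [exact: h1|exact: h2].
  have rho_le t' : a <= t' <= t -> `|rho t'| <= C * w t' * (`|y s t' - x t'| + `|s|).
    move=> /andP[at' t't]; have t'b : t' <= b by exact: le_trans tb.
    have [dt' ht'] := hyp t' at' t't.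
    have hf i : `|f i (y s t') - f i (x t')| <= C * `|y s t' - x t'|.
      rewrite -{1}(subrKC (x t') (y s t')).
      apply: le_trans (hL i _ _ _) _; last by apply: ler_wpM2r.
      move=> z z0 z1; apply: xZ => //; rewrite normrZ ger0_norm//.
      by apply: le_trans (ler_piMl _ z1) _ => //; exact: le_trans ht' r4r.
    have hx i : `|f i (x t')| <= C.
      apply: le_trans (DC i); apply: (hD i [::]) => //.
      by rewrite -[x t']addr0; apply: xZ => //; rewrite normr0 ltW.
    (* Every control multiplies an increment of a field, controlled by |y - x|; those of order r >=
       1 also multiply s ^+ r times the field itself, which is O(s). *)
    have -> : rho t' = \sum_(r < k.+1) \sum_i g r i t' *:
       (s ^+ r *: (f i (y s t') - f i (x t')) + (if r == ord0 then 0 else s ^+ r *: f i (x t'))).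
      rewrite /rho /rs [RHS]exchange_big /= -sumrB; apply: eq_bigr => i _.
      rewrite scaler_suml !big_ord_recl /= expr0 mul1r scale1r addr0 scalerBr addrAC.
      congr (_ + _); apply: eq_bigr => r' _.
      by rewrite -scalerDr subrK scalerA mulrC.
    rewrite /w /control_norm mulrAC mulr_sumr.
    apply: (le_trans (ler_norm_sum _ _ _)); apply: ler_sum => r' _.
    rewrite mulr_sumr; apply: (le_trans (ler_norm_sum _ _ _)); apply: ler_sum => i _.
    rewrite normrZ mulrC; apply: ler_wpM2r => //.
    rewrite mulrDr; apply: (le_trans (ler_normD _ _)); apply: lerD.
      rewrite normrZ normrX; apply: le_trans (hf i).
      by rewrite ler_piMl// exprn_ile1.
    case: eqVneq => [_|r'0]; first by rewrite normr0 mulr_ge0.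
    rewrite normrZ normrX mulrC; apply: ler_pM => //.
    have -> : (r' : nat) = (r' : nat).-1.+1 by rewrite prednK// lt0n.
    by rewrite exprS ler_piMr// exprn_ile1.
  have := gronwall at_ acr dr iw w0 C0 (normr_ge0 s) rho_le at_ (lexx t).
  move=> h; have : `|y s t - x t| <= `|y s t - x t| + `|s| by rewrite lerDl.
  move/le_trans; apply; apply: (le_trans h); apply: ler_wpM2l; first by rewrite addr_ge0.
  by rewrite ler_expR; apply: ler_wpM2l => //; rewrite lerD2r prim_nondecreasing.
(* If |s| and the initial distance are both at most eta, Gronwall's inequality gives 2 * eta * E = r
   / 8, the improvement on r / 4 needed to stay in the tube. *)
pose eta := r / (16 * E).
have eta0 : 0 < eta by rewrite divr_gt0// mulr_gt0.
have etaE : (eta + eta) * E = r / 8.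
  by rewrite /eta; field; rewrite gt_eqF.
have eta_r : eta <= r / 8.
  rewrite -etaE; apply: (@le_trans _ _ ((eta + eta) * 1)); first by rewrite mulr1 lerDl ltW.
  by apply: ler_wpM2l => //; rewrite addr_ge0// ltW.
have jet_e t : a <= t -> t <= b -> forall e, 0 < e -> exists2 d : R, 0 < d &
    forall s, `|s| < d -> chart_dom c (Q s t) /\
      `|y s t - (x t + jet_curve (beta ^~ t) s)| <= e * `|s| ^+ k.
  move=> at_ tb e e0; have [h1 /eqoP h2] := hjet t at_ tb.
  have h : \forall s \near (0 : R), chart_dom c (Q s t) /\
      `|y s t - (x t + jet_curve (beta ^~ t) s)| <= e * `|s ^+ k|.
    by apply: filterI; [exact: h1|exact: (h2 e e0)].
  have /nbhs_ballP[d /= d0 hd] := h.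
  exists d => // s sd; have := hd s; rewrite /ball /= sub0r normrN => /(_ sd)[h3 h4].
  by rewrite -normrX.
have [s0 /andP[s00 s01] hs0] : exists2 s0 : R, 0 < s0 <= 1 & forall s, `|s| < s0 ->
    `|s| <= eta /\ chart_dom c (Q s a) /\ `|y s a - x a| <= eta.
  have [d d0 hd] := jet_e a (lexx a) (ltW ab) 1 ltr01.
  pose B := \sum_j `|beta j a|.
  have B0 : 0 <= B by exact: sumr_ge0.
  have kB : 0 < 1 + k%:R * B by rewrite ltr_pwDl// mulr_ge0.
  (* At time a, the distance to x is at most |s|^k from the remainder plus k * B * |s| from the jet
     curve, hence at most (1 + k * B) * |s|. *)
  exists (Num.min 1 (Num.min d (eta / (1 + k%:R * B)))).
    by rewrite !lt_min ltr01 d0 divr_gt0//= ge_min lexx.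
  move=> s; rewrite !lt_min => /andP[s1 /andP[sd se]].
  have se' : (1 + k%:R * B) * `|s| <= eta.
    by rewrite mulrC -ler_pdivlMr// ltW.
  have s1' : `|s| <= 1 by exact: ltW.
  have [h1 h2] := hd s sd; split; last split => //.
    apply: le_trans se'; rewrite -[leLHS]mul1r; apply: ler_wpM2r => //.
    by rewrite lerDl mulr_ge0.
  have betaB j : `|beta j a| <= B by rewrite /B (bigD1 j)//= lerDl sumr_ge0.
  have h3 := norm_jet_curve betaB B0 s1' (fun j => lexx `|s ^+ j.+1|).
  have h4 : `|s| ^+ k <= `|s|.
    by rewrite -(prednK k0) exprS ler_piMr// exprn_ile1.
  have -> : y s a - x a = (y s a - (x a + jet_curve (beta ^~ a) s)) + jet_curve (beta ^~ a) s.
    by rewrite opprD addrA subrK.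
  apply: (le_trans (ler_normD _ _)); apply: le_trans se'; rewrite mulrDl.
  by apply: lerD => //; apply: (le_trans h2); rewrite !mul1r.
have tube s t : `|s| < s0 -> a <= t -> t <= b ->
    chart_dom c (Q s t) /\ `|y s t - x t| <= r / 4.
  move=> ss0; have [cQ _ _] := tQ s; have [h1 [h2 h3]] := hs0 s ss0.
  apply: (@stay_in_tube R n M c T a b r q (Q s)) => //.
  - exact: ltW.
  - by move=> t' at' t'b h hr; apply: ZA; exact: xZ.
  - exact: le_trans eta_r.
  - move=> t' at' t'b hyp; apply: (le_trans (gron s t' _ at' t'b hyp)).
      by apply: le_trans s01; exact: ltW.
    by rewrite -etaE; apply: ler_wpM2r; [exact: ltW|exact: lerD].
move=> m.
apply: (@jet_ode R n l k A Z r a b s0 f g x y beta) => //.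
- exact: ltW.
- by move=> s t ss0 at_ tb; have [] := tube s t ss0 at_ tb.
- by move=> s ss0; have [] := ode s b (ltW ab) (lexx b) (fun t h1 h2 => (tube s t ss0 h1 h2).1).
- by move=> s ss0; have [] := ode s b (ltW ab) (lexx b) (fun t h1 h2 => (tube s t ss0 h1 h2).1).
- move=> t at_ tb e e0; have [d d0 hd] := jet_e t at_ tb e e0; exists d => // s sd.
  by rewrite jet_poly_full; have [] := hd s sd.
Qed.

End LocalJet.

(** * From compact subintervals to an arbitrary interval *)

Section AlmostEverywhere.
Variable R : realType.
Local Notation mu := (@lebesgue_measure R).

Lemma ae_subsingleton (S : set R) : (forall t t', S t -> S t' -> t = t') ->
  {ae mu, forall t, ~ S t}.
Proof.
move=> hS; have [[t0 St0]|nS] := pselect (exists t, S t); last first.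
  by apply: aeW => t St; apply: nS; exists t.
exists [set t0]; split; [exact: measurable_set1|exact: lebesgue_measure_set1|].
by move=> t /= /contrapT St; exact: hS.
Qed.

(** A point of J other than its minimum or maximum lies between two rationals of J, and there are
    countably many pairs of rationals; a minimum and a maximum form a null set. *)
Lemma ae_interval (J : set R) (P : R -> Prop) : is_interval J ->
  (forall y z, y < z -> J y -> J z -> {ae mu, forall t, y < t < z -> P t}) ->
  {ae mu, forall t, J t -> P t}.
Proof.
move=> iJ h.
have hN : {ae mu, forall t, forall N : nat,
    if unpickle N is Some yz then let (y, z) := (yz : rat * rat) in
      J (ratr y) -> J (ratr z) -> ratr y < t < ratr z -> P t else True}.
  apply: ae_foralln => N; case: unpickle => [[y z]|]; last exact: aeW.
  have [[Jy Jz yz]|nJ] := pselect [/\ J (ratr y), J (ratr z) & ratr y < ratr z :> R].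
    by apply: filterS (h _ _ yz Jy Jz) => t ht _ _.
  by apply: aeW => t Jy Jz /andP[yt tz]; case: nJ; split => //; exact: lt_trans tz.
have hmin := @ae_subsingleton [set t | J t /\ forall t', J t' -> t <= t'] _.
have hmax := @ae_subsingleton [set t | J t /\ forall t', J t' -> t' <= t] _.
have {}hmin : {ae mu, forall t, ~ (J t /\ forall t', J t' -> t <= t')}.
  by apply: hmin => t t' [Jt ht] [Jt' ht']; apply: le_anti; rewrite ht// ht'.
have {}hmax : {ae mu, forall t, ~ (J t /\ forall t', J t' -> t' <= t)}.
  by apply: hmax => t t' [Jt ht] [Jt' ht']; apply: le_anti; rewrite ht// ht'.
apply: filterS3 hN hmin hmax => t htN nmin nmax Jt.
have [y Jy yt] : exists2 y, J y & y < t.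
  apply: contrapT => ny; apply: nmin; split => // t' Jt'; rewrite leNgt; apply/negP => t't.
  by apply: ny; exists t'.
have [z Jz tz] : exists2 z, J z & t < z.
  apply: contrapT => nz; apply: nmax; split => // t' Jt'; rewrite leNgt; apply/negP => tt'.
  by apply: nz; exists t'.
have [p] := rat_in_itvoo yt; rewrite in_itv /= => /andP[yp pt].
have [p'] := rat_in_itvoo tz; rewrite in_itv /= => /andP[tp' p'z].
have := htN (pickle (p, p')); rewrite pickleK; apply.
- by apply: (iJ y t) => //; rewrite !ltW.
- by apply: (iJ t z) => //; rewrite !ltW.
- by rewrite pt.
Qed.

End AlmostEverywhere.

Theorem lemma5p1 (R : realType) (n l k : nat) (M : smooth_manifold R n)
    (X : 'I_l -> vector_field M) (T : R) (q0 : M)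
    (Omega : set (R -> 'rV[R]_l))
    (X_indep : pointwise_independent X)
    (T_gt0 : 0 < T)
    (Omega_meas : forall v, Omega v -> measurable_control T v)
    (Omega_subspace : submod_closed (mem Omega))
    (End_defined : forall v, Omega v -> exists q, trajectory X T q0 v q)
    (u : R -> 'rV[R]_l) (Omega_u : Omega u)
    (q : R -> M) (q_traj : trajectory X T q0 u q)
    (Du : 'I_k -> R -> 'rV[R]_l) (Omega_Du : forall j, Omega (Du j))
    (c : chart R n M) (atlas_c : atlas c)
    (J : set R) (J_itv : is_interval J) (J_sub : J `<=` `[0, T])
    (q_J : q @` J `<=` chart_dom c)
    (b : 'I_k -> R -> 'rV[R]_n)
    (b_jet : forall t, J t ->
      has_jet c (fun s => endpoint X T q0 t (u + jet_curve Du s))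
        (chart_map c (q t)) (b ^~ t)) :
  forall m : 'I_k,
    caratheodory J (b m) (fun t =>
      \sum_(r < k.+1 | (r <= m.+1)%N) \sum_(i < l)
        control_of_order u Du r t 0 i *:
          (\sum_(alpha : multi_index k | mweight alpha == (m.+1 - r)%N)
            ((mfact alpha)%:R)^-1 *:
              iter_diff (X i c) (minsert (b ^~ t) alpha) (chart_map c (q t)))).
Proof.
move=> m; have k0 : (0 < k)%N := leq_ltn_trans (leq0n m) (ltn_ord m).
have Omega_lin a v w : Omega v -> Omega w -> Omega (a *: v + w).
  move=> Ov Ow; have := Omega_subspace.2 a v w.
  by rewrite !inE => h; apply: h.
have Omega0 : Omega 0 by have := Omega_subspace.1; rewrite !inE.
have Omega_V s : Omega (u + jet_curve Du s).
  rewrite addrC -[jet_curve Du s]scale1r; apply: (Omega_lin) => //.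
  by rewrite /jet_curve; elim/big_rec: _ => // j v _ Ov; exact: Omega_lin.
have Omega_ctrl r : Omega (control_of_order u Du r).
  by rewrite /control_of_order; case: unlift => [j|].
pose Q s t := endpoint X T q0 t (u + jet_curve Du s).
have tQ s : trajectory X T q0 (u + jet_curve Du s) (Q s).
  have [q' hq'] := End_defined _ (Omega_V s).
  exact: (@xgetPex _ (fun=> q0) [set q | trajectory X T q0 (u + jet_curve Du s) q] (ex_intro _ q' hq')).
(* Each [Du j] lies in [Omega], so it drives a trajectory of its own, from which its integrability
   is recovered separately. *)
have hg r i : exists h, (@lebesgue_measure R).-integrable setT (EFin \o h) /\
    {ae (@lebesgue_measure R), forall t, 0 < t < T -> h t = control_of_order u Du r t 0 i}.
  have [q' hq'] := End_defined _ (Omega_ctrl r).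
  by have [h ih eh] := trajectory_control_integrable X_indep T_gt0 hq' i; exists h.
have /fin_all_exists[g gP] := fun r => fin_all_exists (hg r).
have ig r i := (gP r i).1.
have eg : {ae (@lebesgue_measure R), forall t, 0 < t < T ->
    forall r i, g r i t = control_of_order u Du r t 0 i}.
  have h : {ae (@lebesgue_measure R), forall t, forall r, forall i, 0 < t < T ->
      g r i t = control_of_order u Du r t 0 i}.
    by apply: filter_forall => r; apply: filter_forall => i; exact: (gP r i).2.
  by apply: filterS h => t ht tT r i; exact: ht.
have loc y z : y < z -> J y -> J z -> abs_continuous y z (b m) /\
    {ae (@lebesgue_measure R), forall t, y < t < z -> is_derive t 1 (b m)
      (jet_rhs (fun i => X i c) g (fun t => chart_map c (q t)) b m.+1 t)}.
  move=> yz Jy Jz.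
  have Jt t : y <= t -> t <= z -> J t by move=> yt tz; apply: (J_itv y z) => //; rewrite yt.
  have := J_sub _ Jy; have := J_sub _ Jz; rewrite /= !in_itv /= => /andP[_ zT] /andP[y0 _].
  apply: (local_jet_ode k0 y0 yz zT atlas_c q_traj tQ ig eg).
  - by move=> t yt tz; apply: q_J; exists t => //; exact: Jt.
  - by move=> t yt tz; apply: b_jet; exact: Jt.
split.
  move=> y z; rewrite le_eqVlt => /orP[/eqP <- _|yz yzJ]; last first.
    by have [] := loc y z yz (yzJ y _) (yzJ z _); rewrite //= in_itv /= ?lexx ltW.
  (* The local result needs y < z; on a one-point interval all increments vanish. *)
  move=> e e0; exists 1 => // N I hI _ _; rewrite big1// => i _.
  have [h1 [h2 h3]] := hI i.
  have E1 : (I i).1 = y by apply: le_anti; rewrite h1 (le_trans h2).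
  have E2 : (I i).2 = y by apply: le_anti; rewrite h3 (le_trans h1).
  by rewrite E1 E2 subrr normr0.
apply: ae_interval => // y z yz Jy Jz; have [_ h] := loc y z yz Jy Jz.
have := J_sub _ Jy; have := J_sub _ Jz; rewrite /= !in_itv /= => /andP[_ zT] /andP[y0 _].
(* The representatives g are turned back into the controls, which they equal almost everywhere on
   ]0, T[ and hence on ]y, z[. *)
apply: filterS2 h eg => t hd he tyz; apply: is_derive_eq (hd tyz) _.
apply: eq_bigr => r _; apply: eq_bigr => i _; rewrite he//.
by move: tyz => /andP[? ?]; apply/andP; split; [exact: le_lt_trans y0 _|exact: lt_le_trans zT].
Qed.
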